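(* (i) The function $u\mapsto(2u)\wedge1$ on $[0,1]$ is a p*-to-p calibrator, and it dominates all other p*-to-p calibrators. (ii) An increasing function $f:[0,1]\to[0,\infty)$ is an admissible p-to-p* calibrator if and only if $f$ is left-continuous, $f(0)=0$, $\int_0^vf(u)\,\mathrm du\ge v^2/2$ for all $v\in(0,1)$, and $\int_0^1f(u)\,\mathrm du=1/2$.
   Context: All random variables live on a fixed atomless probability space. ''Increasing'' is in the non-strict sense. For random variables $X,Y$: $X\le_1 Y$ means $\mathbb E[f(X)]\le \mathbb E[f(Y)]$ for all increasing real functions $f$ such that the expectations exist; $X\le_2 Y$ means the same inequality for all increasing concave real functions $f$ such that the expectations exist. With $U$ uniform on $[0,1]$: $P$ is a p-variable if $U\le_1 P$ (equivalently $\mathbb P(P\le\alpha)\le\alpha$ for all $\alpha\in(0,1)$); $P$ is a p*-variable if $U\le_2 P$. A p-to-p* calibrator is an increasing function $f:[0,1]\to[0,\infty)$ such that $f(P)$ is a p*-variable for every p-variable $P$; a p*-to-p calibrator is an increasing function $g:[0,1]\to[0,\infty)$ such that $g(P)$ is a p-variable for every p*-variable $P$. Input p-variables and p*-variables with values larger than $1$ are treated as $1$ (i.e. $P$ is replaced by $P\wedge1$). A calibrator $f$ dominates a calibrator $g$ of the same kind if $f\le g$ pointwise, and strictly dominates it if moreover $f\ne g$. A calibrator is admissible if it is not strictly dominated by another calibrator of the same kind. *)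

(* Defs.v *)
From HB Require Import structures.
From mathcomp Require Import all_boot all_order all_algebra.
From mathcomp Require Import all_classical all_reals all_analysis.

Set Implicit Arguments.
Unset Strict Implicit.
Unset Printing Implicit Defensive.

Import Order.TTheory GRing.Theory Num.Theory.
Import numFieldNormedType.Exports.

Local Open Scope classical_set_scope.
Local Open Scope ring_scope.

Section StochasticOrders.
Context (R : realType) (d : measure_display) (T : measurableType d).
Variable P : probability T R.

Definition atomless : Prop :=
  forall A : set T, measurable A -> (0 < P A)%E ->
    exists B : set T,
      [/\ measurable B, B `<=` A, (0 < P B)%E & (P B < P A)%E].

(* The expectation exists in [-oo, +oo], i.e., it is not of the form oo - oo.
   Finiteness must not be required: a nonconstant increasing concave function
   of a variable with E[X^-] = +oo is never integrable, so with integrability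
   such an X would vacuously be larger than everything in the order st_le2. *)
Definition expectation_exists (X : T -> R) : Prop :=
  (\int[P]_w (EFin \o X)^\+ w < +oo)%E \/ (\int[P]_w (EFin \o X)^\- w < +oo)%E.

Definition concave_fun (f : R -> R) : Prop :=
  convex_function (setT : set R^o) (fun x : R^o => - f x : R^o).

Definition st_le1 (X Y : T -> R) : Prop :=
  forall f : R -> R, {homo f : x y / x <= y} ->
    expectation_exists (f \o X) -> expectation_exists (f \o Y) ->
    ('E_P[f \o X] <= 'E_P[f \o Y])%E.

Definition st_le2 (X Y : T -> R) : Prop :=
  forall f : R -> R, {homo f : x y / x <= y} -> concave_fun f ->
    expectation_exists (f \o X) -> expectation_exists (f \o Y) ->
    ('E_P[f \o X] <= 'E_P[f \o Y])%E.

Definition uniform01 (U : {RV P >-> R}) : Prop :=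
  forall A : set R, measurable A ->
    distribution P U A = uniform_prob (@ltr01 R) A.

(* The orders only depend on the laws of the variables, and an atomless space
   carries a uniform variable, so the choice of U is immaterial. *)
Definition p_variable (X : T -> R) : Prop :=
  measurable_fun setT X /\ exists U : {RV P >-> R}, uniform01 U /\ st_le1 U X.

Definition pstar_variable (X : T -> R) : Prop :=
  measurable_fun setT X /\ exists U : {RV P >-> R}, uniform01 U /\ st_le2 U X.

(* Increasing functions [0,1] -> [0,oo) are represented by functions R -> R;
   their values outside [0,1] are never used. *)
Definition increasing01 (f : R -> R) : Prop :=
  {in `[0, 1], forall u, 0 <= f u} /\
  {in `[0, 1] &, {homo f : u v / u <= v}}.

(* Values larger than 1 are treated as 1. p-variables and p*-variables are
   nonnegative only almost surely, so values on the null event {x < 0} are sent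
   to 0 to stay in the domain of a calibrator. *)
Definition clamp01 (x : R) : R := Num.min (Num.max x 0) 1.

Definition p_to_pstar_calibrator (f : R -> R) : Prop :=
  increasing01 f /\
  forall X : T -> R, p_variable X -> pstar_variable (f \o clamp01 \o X).

Definition pstar_to_p_calibrator (g : R -> R) : Prop :=
  increasing01 g /\
  forall X : T -> R, pstar_variable X -> p_variable (g \o clamp01 \o X).

Definition dominates_cal (f g : R -> R) : Prop :=
  {in `[0, 1], forall u, f u <= g u}.

Definition strictly_dominates_cal (f g : R -> R) : Prop :=
  dominates_cal f g /\ ~ {in `[0, 1], f =1 g}.

Definition admissible (calibrator : (R -> R) -> Prop) (f : R -> R) : Prop :=
  calibrator f /\ ~ exists g, calibrator g /\ strictly_dominates_cal g f.

End StochasticOrders.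

(* Left-continuity on [0,1]; at 0 there is nothing to require. *)
Definition left_continuous01 (R : realType) (f : R -> R) : Prop :=
  forall u : R, 0 < u <= 1 -> f x @[x --> u^'-] --> f u.

(* Main.v *)
(* A p*-variable X satisfies E(c - X)^+ <= c^2/2 for c in [0,1], by testing with
   the concave function x |-> - (c - x)^+.  Markov's inequality turns this into
   P(X <= c/2) <= c, so doubling calibrates; replacing a uniform U by u on
   {U <= 2u} shows that nothing smaller does.  Taking X = f(U) and c = v it gives
   int_0^v f >= v^2/2.  Conversely, if this holds for all v and phi is concave
   with supergradient g, then phi(f(U)) - phi(U) >= g(f(U)) (f(U) - U), and the
   weight g(f(U)) is a nonnegative decreasing function of U, hence a mixture of
   indicators of initial segments, against each of which f(U) - U has
   nonnegative expectation.  So p-to-p* calibrators are exactly the increasing f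
   with int_0^v f >= v^2/2 on [0,1], and admissibility is a minimality question
   inside this class.  A uniform variable on the atomless space is read off a
   maximal chain of measurable sets. *)

Require Import Defs.
From HB Require Import structures.
From mathcomp Require Import all_boot all_order all_algebra.
From mathcomp Require Import all_classical all_reals all_analysis.
From mathcomp Require Import measurable_realfun ring lra.

Set Implicit Arguments.
Unset Strict Implicit.
Unset Printing Implicit Defensive.

Import Order.TTheory GRing.Theory Num.Theory.
Import numFieldNormedType.Exports.

Local Open Scope classical_set_scope.
Local Open Scope ring_scope.

(** * Uniform variables on atomless spaces *)

Section AtomlessUniform.
Context (R : realType) (d : measure_display) (T : measurableType d).
Variable P : probability T R.

(* Members of equal measure coincide, so null sets create no ambiguity. *)
Definition measure_chain (C : set (set T)) : Prop :=
  C `<=` measurable /\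
  forall A B, C A -> C B -> (P A <= P B)%E -> A `<=` B.

(** Maximality only speaks up to measure: a set comparable with every member but of the same measure
    as a different member cannot be adjoined, since members of equal measure must coincide. *)
Definition saturated (C : set (set T)) : Prop :=
  forall A, measurable A -> (forall B, C B -> A `<=` B \/ B `<=` A) ->
    exists2 B, C B & P B = P A.

(** Zorn's lemma gives a maximal chain. A comparable set whose measure no member has could be
    adjoined without breaking the ordering condition. *)
Lemma exists_saturated_chain :
  exists C, measure_chain C /\ saturated C.
Proof.
have [F Fchain totF|C [[mC ordC] maxC]] := @Zorn_bigcup _ measure_chain.
  split=> [A [C FC CA]|A B [C FC CA] [D FD DB]].
    by have [mC _] := Fchain _ FC; exact: mC.
  have [CD|DC] := totF _ _ FC FD.
    by have [_] := Fchain _ FD; apply => //; exact: CD.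
  by have [_] := Fchain _ FC; apply => //; exact: DC.
exists C; split=> // A mA compA; apply: contrapT => noB.
have nCA : ~ C A by move=> CA; apply: noB; exists A.
apply: (maxC (C `|` [set A])).
  split=> [|]; first exact: subsetUl.
  by move=> /(_ A) CA; apply/nCA/CA; right.
split=> [B [/mC//|->//]|B1 B2 [CB1|->] [CB2|->]] PB //.
- exact: ordC.
- have [AB|//] := compA _ CB1.
  case: noB; exists B1 => //; apply/eqP.
  by rewrite eq_le PB le_measure ?inE//; exact: mC.
- have [//|BA] := compA _ CB2.
  case: noB; exists B2 => //; apply/eqP.
  by rewrite eq_le PB andbT le_measure ?inE//; exact: mC.
Qed.

(** Passing to complements turns approximation from below into approximation from above. *)
Lemma chain_setC C : measure_chain C -> measure_chain (setC @` C).
Proof.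
move=> [mC ordC]; split=> [_ [A CA <-]|_ _ [A CA <-] [B CB <-]].
  exact/measurableC/mC.
rewrite !probability_setC; [|exact: mC..].
rewrite leeD2lE// leeN2 => /ordC BA.
by apply: subsetC; exact: BA.
Qed.

Lemma saturated_setC C : measure_chain C -> saturated C ->
  saturated (setC @` C).
Proof.
move=> [mC _] satC A mA compA.
have [|B CB|B CB PB] := satC (~` A); first exact: measurableC.
  have [|AB|BA] := compA (~` B); first by exists B.
    by right=> x Bx Ax; exact: AB Ax Bx.
  by left=> x nAx; apply: contrapT => /BA.
exists (~` B); first by exists B.
by rewrite probability_setC ?PB ?probability_setC ?oppeB ?addeA ?subee ?add0e//;
  exact: mC.
Qed.

(** The supremum of the measures that are at most [t] is attained: the union of members approaching
    it is comparable with the whole chain, so saturation supplies a member of that measure. *)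
Lemma saturated_lower C (t : R) : measure_chain C -> saturated C -> 0 <= t ->
  exists A, [/\ C A, (P A <= t%:E)%E &
    forall B, C B -> (P B <= t%:E)%E -> (P B <= P A)%E].
Proof.
move=> [mC ordC] satC t0.
have PE A : C A -> P A = (fine (P A))%:E.
  by move=> /mC mA; rewrite fineK// fin_num_measure.
pose V := [set x | exists A, [/\ C A, P A = x%:E & x <= t]].
have V0 : V !=set0.
  have [//|B CB|B CB PB] := satC set0; first by left.
  by exists 0, B; split=> //; rewrite PB measure0.
have Vt : ubound V t by move=> x [A []].
have supV : has_sup V by split=> //; exists t.
have /choice[A /all_and3[CA PA At]] : forall n : nat, exists A,
    [/\ C A, ((sup V - n.+1%:R^-1)%:E < P A)%E & (P A <= t%:E)%E].
  move=> n; have [|x [A [CA PA xt]] xV] := @sup_adherent _ V n.+1%:R^-1 _ supV.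
    by rewrite invr_gt0.
  by exists A; split=> //; rewrite PA ?lte_fin ?lee_fin.
(* In a chain each finite union is one of its terms, so continuity from below bounds the measure of
   the countable union by [t]. *)
pose G n := \big[setU/set0]_(i < n.+1) A i.
have GA n : exists m, G n = A m.
  elim: n => [|n [m Gm]]; first by exists 0%N; rewrite /G big_ord1.
  rewrite /G big_ord_recr/= -/(G n) Gm.
  have [mn|/ltW mn] := leP (P (A m)) (P (A n.+1)).
    by exists n.+1; apply/setUidPr; apply: ordC.
  by exists m; apply/setUidPl; apply: ordC.
have mA n : measurable (A n) by exact: mC.
have [||B CB PB] := satC (\bigcup_n A n); first exact: bigcup_measurable.
  move=> B CB; have [[n PBn]|H] := pselect (exists n, (P B <= P (A n))%E).
    by right; apply: (subset_trans (ordC _ _ CB (CA n) PBn)); exact: bigcup_sup.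
  left; apply: bigcup_sub => n _; apply: ordC => //.
  by rewrite leNgt; apply/negP => /ltW ?; apply: H; exists n.
have Bt : (P B <= t%:E)%E.
  rewrite PB -bigcup_bigsetU_bigcup.
  apply: (@cvge_le _ \oo _ _ (P \o G)); last first.
    apply: nondecreasing_cvg_mu.
    - by move=> n; have [m ->] := GA n.
    - by apply: bigcup_measurable => n _; have [m ->] := GA n.
    - apply/nondecreasing_seqP => n; apply/subsetPset.
      by rewrite /G [X in _ `<=` X]big_ord_recr/=; exact: subsetUl.
  by apply: nearW => n /=; have [m ->] := GA n.
exists B; split=> // D CD Dt.
suff supB : ((sup V)%:E <= P B)%E.
  apply: le_trans supB; rewrite PE// lee_fin.
  apply: ub_le_sup; first by case: supV.
  by exists D; rewrite -PE//; split=> //; rewrite -lee_fin -PE.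
have AB n : (P (A n) <= P B)%E.
  by rewrite PB le_measure ?inE//; [exact: bigcup_measurable|exact: bigcup_sup].
rewrite (PE B)// lee_fin leNgt; apply/negP => /[dup] h.
move=> /ltr_add_invr[n]; apply/negP; rewrite -leNgt.
have := lt_le_trans (PA n) (AB n); rewrite (PE B)// lte_fin => /ltW.
by rewrite lerBlDr.
Qed.

Lemma saturated_upper C (t : R) : measure_chain C -> saturated C -> t <= 1 ->
  exists A, [/\ C A, (t%:E <= P A)%E &
    forall B, C B -> (t%:E <= P B)%E -> (P A <= P B)%E].
Proof.
move=> chC satC t1.
have [] := @saturated_lower _ (1 - t) (chain_setC chC) (saturated_setC chC satC).
  by rewrite subr_ge0.
case: chC => mC _.
have PE A : C A -> P A = (fine (P A))%:E.
  by move=> /mC mA; rewrite fineK// fin_num_measure.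
move=> _ [[A CA <-]]; rewrite probability_setC; last exact: mC.
rewrite (PE A)// -EFinB lee_fin => At AP; exists A; split=> //.
  by rewrite PE// lee_fin; lra.
move=> B CB; have /(_ _)/wrap[] := AP (~` B); first by exists B.
rewrite probability_setC; last exact: mC.
by rewrite (PE A)// (PE B)// -!EFinB !lee_fin => H tB;
  have := H ltac:(lra); lra.
Qed.

Hypothesis P_atomless : atomless P.

(** Otherwise [t] lies strictly between the measures of the best lower and upper members [A] and
    [B]. Atomlessness yields [E] inside the difference with [A] united with [E] comparable to every
    member; saturation then gives a member of measure strictly between, against the choice of [A] or
    [B]. *)
Lemma saturated_value C (t : R) : measure_chain C -> saturated C ->
  0 <= t <= 1 -> exists2 A, C A & P A = t%:E.
Proof.
move=> chC satC /andP[t0 t1].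
have [A [CA At maxA]] := saturated_lower chC satC t0.
have [B [CB tB minB]] := saturated_upper chC satC t1.
case: (chC) => mC ordC.
have [mA mB] := (mC _ CA, mC _ CB).
have [PAt|nAt] := eqVneq (P A) t%:E; first by exists A.
have [PBt|nBt] := eqVneq (P B) t%:E; first by exists B.
have {nAt}At : (P A < t%:E)%E by rewrite lt_neqAle nAt.
have {nBt}tB : (t%:E < P B)%E by rewrite lt_neqAle eq_sym nBt.
have AB : A `<=` B by apply: ordC => //; apply: ltW; exact: lt_trans tB.
have PBA : P (B `\` A) = (P B - P A)%E.
  by rewrite measureD// ?setIidr// -ge0_fin_numE// fin_num_measure.
have [||E [mE EBA E0 EBAlt]] := P_atomless (A := B `\` A).
- exact: measurableD.
- by rewrite PBA sube_gt0 (lt_trans At).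
have AE : A `&` E = set0.
  by rewrite -subset0 => x [Ax /EBA []].
have PAE : P (A `|` E) = (P A + P E)%E by rewrite measureU.
have PE X : measurable X -> P X = (fine (P X))%:E.
  by move=> mX; rewrite fineK// fin_num_measure.
have [||Y CY PY] := satC (A `|` E); first exact: measurableU.
  move=> X CX; have [Xt|/ltW tX] := leP (P X) t%:E.
    right; apply: (@subset_trans _ A); last exact: subsetUl.
    by apply: ordC => //; exact: maxA.
  left; apply: (@subset_trans _ B); last by apply: ordC => //; exact: minB.
  by rewrite subUset; split=> // x /EBA [].
exfalso; have [/(maxA _ CY)|/ltW/(minB _ CY)] := leP (P Y) t%:E.
  rewrite PY PAE; move: E0.
  rewrite (PE _ mA) (PE _ mE) -!EFinD lte_fin lee_fin; lra.
rewrite PY PAE; move: EBAlt.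
rewrite PBA (PE _ mA) (PE _ mE) (PE _ mB) -!EFinD lte_fin lee_fin; lra.
Qed.

End AtomlessUniform.

(** * The uniform law and its distribution function *)

Section UniformLaw.
Context (R : realType).

Lemma uniform_prob_ray (x : R) : 0 <= x <= 1 ->
  uniform_prob (@ltr01 R) `]-oo, x]%classic = x%:E.
Proof.
move=> /andP[x0 x1]; rewrite /uniform_prob integral_uniform_pdf.
have -> : `]-oo, x]%classic `&` `[0, 1]%classic = `[0, x]%classic :> set R.
  apply/seteqP; split=> u /=; rewrite !in_itv/=.
    by move=> [ux /andP[-> _]].
  by move=> /andP[-> ux]; rewrite ux (le_trans ux).
rewrite (eq_integral (cst 1%E)); last first.
  move=> u; rewrite inE/= in_itv/= => /andP[u0 ux].
  by rewrite /uniform_pdf u0 (le_trans ux x1)/= subr0 invr1.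
rewrite integral_cst//= mul1e lebesgue_measure_itv/= lte_fin.
by case: ltgtP x0 => // [_|<-] _; rewrite ?sube0.
Qed.

(** The closed left rays form a generating class stable under intersection, and countably many of
    them cover the line. *)
Lemma probability_eq_rays (Q1 Q2 : probability R R) :
    (forall x : R, Q1 `]-oo, x]%classic = Q2 `]-oo, x]%classic) ->
  forall A, measurable A -> Q1 A = Q2 A.
Proof.
move=> Q12; pose G : set (set R) := [set A | exists x, A = `]-oo, x]%classic].
apply: (@measure_unique _ _ _ G (fun n => `]-oo, n%:R]%classic)).
- rewrite eqEsubset; split; last first.
    by apply: smallest_sub; [exact: sigma_algebra_measurable|move=> _ [x ->]].
  rewrite [X in X `<=` _](RGenOInfty.measurableE R).
  apply: smallest_sub; first exact: smallest_sigma_algebra.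
  move=> _ [x ->]; rewrite -setCitvl -[X in <<s _ >> X]setTD.
  by apply: sigma_algebraCD; apply: sub_sigma_algebra; exists x.
- move=> _ _ [x ->] [y ->]; exists (Num.min x y).
  by apply/seteqP; split=> u /=; rewrite !in_itv/= le_min => /andP.
- by move=> n; exists n%:R.
- apply/seteqP; split=> // x _; exists (Num.bound `|x|) => //=.
  by rewrite in_itv/=; exact: (le_trans (ler_norm x) (ltW (archi_boundP (normr_ge0 x)))).
- by move=> _ [x ->]; exact: Q12.
- by move=> n; rewrite (le_lt_trans (probability_le1 _ _)) ?ltry.
Qed.

Context (d : measure_display) (T : measurableType d) (P : probability T R).

Lemma uniform01_cdf (U : {RV P >-> R}) : uniform01 U ->
  forall x, 0 <= x <= 1 -> P [set w | U w <= x] = x%:E.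
Proof.
move=> unifU x x01; by rewrite -(uniform_prob_ray x01) -unifU.
Qed.

Lemma cdf_uniform01 (U : {RV P >-> R}) :
  (forall x, 0 <= x <= 1 -> P [set w | U w <= x] = x%:E) -> uniform01 U.
Proof.
move=> cdfU; have dU x : distribution P U `]-oo, x]%classic = P [set w | U w <= x].
  by rewrite /distribution /pushforward; congr (P _); apply: eq_set => w;
    rewrite /= in_itv.
(* [uniform_prob] lives on [measurableTypeR R], whose display is not that of
   [R]; the identity transports it. *)
pose idTR : measurableTypeR R -> R := idfun.
have mid : measurable_fun setT idTR by exact: measurable_id.
pose V : {mfun measurableTypeR R >-> R} :=
  HB.pack idTR (isMeasurableFun.Build _ _ _ _ idTR mid).
suff UV A : measurable A -> distribution P U A =
    distribution (uniform_prob (@ltr01 R)) V A.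
  by move=> A mA; rewrite UV.
have dV x : 0 <= x <= 1 ->
    distribution (uniform_prob (@ltr01 R)) V `]-oo, x] = x%:E.
  exact: uniform_prob_ray.
apply: (@probability_eq_rays (distribution P U)
  (distribution (uniform_prob (@ltr01 R)) V)) => {A}x.
have i01 : 0 <= (0 : R) <= 1 by rewrite lexx ler01.
have i11 : 0 <= (1 : R) <= 1 by rewrite lexx ler01.
have mono (Q : probability R R) (y z : R) : y <= z ->
    (Q `]-oo, y]%classic <= Q `]-oo, z]%classic)%E.
  move=> yz; rewrite le_measure ?inE//.
  by apply: subset_itvl; rewrite bnd_simp.
have [x0|x0] := ltP x 0.
  have z0 (Q : probability R R) : Q `]-oo, 0]%classic = 0%E -> Q `]-oo, x]%classic = 0%E.
    by move=> Q0; apply/eqP; rewrite eq_le measure_ge0 -Q0 mono// ltW.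
  by rewrite !z0//; [exact: dV|rewrite [LHS]dU cdfU].
have [x1|x1] := leP x 1.
  by rewrite [RHS]dV ?x0// [LHS]dU cdfU ?x0.
have z1 (Q : probability R R) : Q `]-oo, 1]%classic = 1%E -> Q `]-oo, x]%classic = 1%E.
  by move=> Q1; apply/eqP; rewrite eq_le probability_le1// -Q1 mono// ltW.
by rewrite !z1//; [exact: dV|rewrite [LHS]dU cdfU].
Qed.

Hypothesis P_atomless : atomless P.

(* [S t] is a member of measure [t] of a maximal chain; [U] is the first
   index at which a point enters the chain. *)
Lemma atomless_uniform : exists U : {RV P >-> R}, uniform01 U.
Proof.
have [C [chC satC]] := exists_saturated_chain P.
have /choice[S0 S0P] : forall t : R, exists A,
    0 <= t <= 1 -> C A /\ P A = t%:E.
  move=> t; have [t01|_] := boolP (0 <= t <= 1); last by exists setT.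
  have [A CA PA] := saturated_value P_atomless chC satC t01.
  by exists A.
(* Taking the empty set below 0 and the whole space from 1 on gives every point an entry index in
   [0,1]. *)
pose S t := if 0 <= t then if t < 1 then S0 t else setT else set0.
have mS t : measurable (S t).
  rewrite /S; case: ifPn => // t0; case: ifPn => // t1.
  by case: chC => mC _; apply: mC; have [] := S0P t; rewrite ?t0 ?ltW.
have PS t : 0 <= t <= 1 -> P (S t) = t%:E.
  rewrite /S => /andP[t0]; rewrite le_eqVlt => /predU1P[->|t1].
    by rewrite ler01 ltxx probability_setT.
  by rewrite t0 t1; have [] := S0P t; rewrite ?t0 ?ltW.
have leS s t : s <= t -> S s `<=` S t.
  move=> st; rewrite /S; case: ifPn => [s0|_]; last exact: sub0set.
  rewrite (le_trans s0 st).
  case: ifPn => [s1|]; last by rewrite -leNgt => s1; rewrite ltNge (le_trans s1).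
  case: ifPn => [t1|_]; last exact: subsetT.
  have [|Cs Ps] := S0P s; first by rewrite s0 ltW.
  have [|Ct Pt] := S0P t; first by rewrite (le_trans s0 st) ltW.
  by case: chC => _; apply => //; rewrite Ps Pt.
pose U w := inf [set t | S t w].
have lbU w : lbound [set t | S t w] 0.
  by move=> t/=; rewrite /S; case: ifP.
have infU w : has_inf [set t | S t w].
  by split; [exists 1; rewrite /= /S ler01 ltxx|exists 0].
have US t w : S t w -> U w <= t.
  by move=> Stw; apply: ge_inf => //; case: (infU w).
have SU t w : U w < t -> exists2 s, s < t & S s w.
  rewrite -subr_gt0 => Ut; have [s Ss] := inf_adherent Ut (infU w).
  by rewrite addrC subrK => st; exists s.
have mU : measurable_fun setT U.
  apply: (measurability _ (RGenInftyO.measurableE R)) => _ [_ [r ->] <-].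
  rewrite setTI.
  have -> : U @^-1` `]-oo, r[ =
      \bigcup_(q : rat) (if ratr q < r then S (ratr q) else set0).
    apply/seteqP; split=> w /=; rewrite in_itv/=.
      move=> /SU[s sr Ssw].
      have [q] := rat_in_itvoo sr; rewrite in_itv/= => /andP[sq qr].
      by exists q => //; rewrite qr; apply: leS Ssw; exact: ltW.
    by move=> [q _]; case: ifPn => // qr /US /le_lt_trans; exact.
  by apply: bigcupT_measurable_rat => q; case: ifP.
pose U' : {mfun T >-> R} := HB.pack U (isMeasurableFun.Build _ _ _ _ U mU).
exists U'.
apply: cdf_uniform01 => x /andP[x0 x1] /=.
have mUx : measurable [set w | U w <= x].
  rewrite -[X in measurable X]setTI.
  have := mU measurableT `]-oo, x]%classic (measurable_itv _).
  by congr measurable; congr (_ `&` _); apply: eq_set => w; rewrite in_itv.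
(* The event [U <= x] contains [S x], which gives the lower bound. As the infimum need not be
   attained, the event is only known to lie in [S r] for each [r > x], and the upper bound follows
   by letting [r] decrease to [x]. *)
apply/eqP; rewrite eq_le; apply/andP; split; last first.
  rewrite -PS ?x0// le_measure ?inE// => w; exact: US.
have [xlt1|x1'] := ltP x 1; last first.
  by rewrite (le_trans (probability_le1 _ _))// lee_fin.
rewrite -[P _]fineK ?fin_num_measure// lee_fin.
apply/ler_addgt0Pr => e; rewrite -(ltrDl x); move: (x + e) => r xr; have [r1|r1] := leP r 1; last first.
  by rewrite ltW// (le_lt_trans _ r1)// -lee_fin fineK ?fin_num_measure// probability_le1.
rewrite -lee_fin fineK ?fin_num_measure// -(PS r); last first.
  by rewrite r1 andbT (le_trans x0)// ltW.
rewrite le_measure ?inE// => w /= Uwx.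
have [s sr] := SU r w (le_lt_trans Uwx xr).
by apply: leS; exact: ltW.
Qed.

End UniformLaw.

(** * Supergradients and weighted expectations *)

Section Concave.
Context (R : realType).
Implicit Types (phi f : R -> R).

(** The three-slope inequality with denominators cleared; [b] is the convex combination with weight
    [(c - b) / (c - a)] on [a]. *)
Lemma concave_slopes phi (a b c : R) : concave_fun phi -> a < b -> b < c ->
  (phi c - phi b) * (b - a) <= (phi b - phi a) * (c - b).
Proof.
move=> cphi ab bc; have ac : 0 < c - a by rewrite subr_gt0 (lt_trans ab).
have t0 : 0 <= (c - b) / (c - a) by rewrite divr_ge0 ?subr_ge0 ?ltW// (lt_trans ab).
have t1 : (c - b) / (c - a) <= 1 by rewrite ler_pdivrMr// mul1r lerD2l lerN2 ltW.
have := @cphi (Itv01 t0 t1) a c (mem_set I) (mem_set I).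
rewrite !convRE/= /unstable.onem.
have bE : (c - b) / (c - a) * a + (1 - (c - b) / (c - a)) * c = b.
  by field; rewrite gt_eqF.
rewrite -[X in - phi X <= _]/((c - b) / (c - a) * a + (1 - (c - b) / (c - a)) * c).
rewrite bE -(ler_pM2r ac).
have -> : ((c - b) / (c - a) * - phi a + (1 - (c - b) / (c - a)) * - phi c)
    * (c - a) = - ((c - b) * phi a + (b - a) * phi c).
  by field; rewrite gt_eqF.
lra.
Qed.

(** [g] is the left derivative, obtained as the infimum of the left difference quotients, which the
    right quotients bound from below. Its monotonicity results from adding the supergradient
    inequalities at two points. *)
Lemma concave_supergradient phi : {homo phi : x y / x <= y} -> concave_fun phi ->
  exists g : R -> R, [/\ forall y, 0 <= g y, {homo g : x y /~ x <= y} &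
    forall x y, phi x <= phi y + g y * (x - y)].
Proof.
move=> hphi cphi.
pose V y := [set (phi y - phi (y - h)) / h | h in [set h : R | 0 < h]].
have V0 y : V y !=set0 by exists ((phi y - phi (y - 1)) / 1); exists 1 => //=.
have lbV x y : y < x -> lbound (V y) ((phi x - phi y) / (x - y)).
  move=> yx _ [h /= h0 <-]; rewrite ler_pdivrMr ?subr_gt0// mulrAC.
  rewrite ler_pdivlMr//.
  have := @concave_slopes phi (y - h) y x cphi.
  by rewrite ltrBlDr ltrDl h0 => /(_ isT yx); rewrite subKr.
have infV y : has_inf (V y).
  by split=> //; exists ((phi (y + 1) - phi y) / (y + 1 - y));
    apply: lbV; rewrite ltrDl.
pose g y := inf (V y).
have g0 y : 0 <= g y.
  apply: lb_le_inf => // _ [h /= h0 <-].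
  apply: divr_ge0; last exact: ltW.
  by rewrite subr_ge0 hphi// lerBlDr lerDl ltW.
have sg x y : phi x <= phi y + g y * (x - y).
  have [xy|yx|->] := ltgtP x y; last by rewrite subrr mulr0 addr0.
    have : g y <= (phi y - phi x) / (y - x).
      apply: ge_inf; first by case: (infV y).
      by exists (y - x) => /=; rewrite ?subr_gt0// subKr.
    by rewrite ler_pdivlMr ?subr_gt0//; lra.
  have : (phi x - phi y) / (x - y) <= g y.
    by apply: lb_le_inf => //; exact: lbV.
  by rewrite ler_pdivrMr ?subr_gt0//; lra.
exists g; split=> // x y; rewrite le_eqVlt => /predU1P[->//|yx].
rewrite -(ler_pM2r (_ : 0 < x - y)) ?subr_gt0//.
by have := sg x y; have := sg y x; lra.
Qed.

(** The sum is the ceiling of [x], written through indicators so that a weight can be approximated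
    by its superlevel sets. *)
Lemma step_approx (N : nat) (x : R) : 0 <= x <= N%:R ->
  x <= \sum_(k < N) (k%:R < x)%R%:R <= x + 1.
Proof.
elim: N => [|N IH] /andP[x0 xN]; first by rewrite big_ord0; lra.
rewrite big_ord_recr/=; have [Nx|xN'] := ltP.
  rewrite (eq_bigr (fun=> 1)) => [|k _]; last first.
    by rewrite (lt_trans _ Nx)// ltr_nat.
  rewrite sumr_const card_ord.
  by move: xN Nx; rewrite -natr1 mulr1n => xN Nx; apply/andP; split; lra.
by rewrite addr0 IH// x0.
Qed.

End Concave.

(** * Bounded variables and their expectations *)

Section BoundedVariables.
Context (R : realType) (d : measure_display) (T : measurableType d).
Variable P : probability T R.
Implicit Types X Y W H : T -> R.

(** Unlike integrability, boundedness is stable under products, in particular with weights and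
    indicators. *)
Definition bounded_rv X : Prop :=
  measurable_fun setT X /\ exists M, forall w, `|X w| <= M.

Lemma bounded_rv_integrable X : bounded_rv X -> P.-integrable setT (EFin \o X).
Proof.
move=> [mX [M XM]]; apply: measurable_bounded_integrable => //.
  by rewrite -ge0_fin_numE// fin_num_measure.
exists M; split; first exact: num_real.
by move=> N MN w _ /=; exact: le_trans (XM w) (ltW MN).
Qed.

Lemma bounded_rv_cst (c : R) : bounded_rv (cst c).
Proof. by split=> //; exists `|c|. Qed.

Lemma bounded_rvD X Y : bounded_rv X -> bounded_rv Y -> bounded_rv (X \+ Y).
Proof.
move=> [mX [M XM]] [mY [N YN]]; split.
  exact: measurable_funD.
by exists (M + N) => w; rewrite (le_trans (ler_normD _ _))// lerD.
Qed.

Lemma bounded_rvM X Y : bounded_rv X -> bounded_rv Y -> bounded_rv (X \* Y).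
Proof.
move=> [mX [M XM]] [mY [N YN]]; split.
  exact: measurable_funM.
by exists (M * N) => w; rewrite normrM ler_pM.
Qed.

Lemma bounded_rvB X Y : bounded_rv X -> bounded_rv Y -> bounded_rv (X \- Y).
Proof.
move=> bX bY; have -> : X \- Y = X \+ (cst (- 1) \* Y).
  by apply/funext => w /=; rewrite mulN1r.
by apply: bounded_rvD => //; apply: bounded_rvM => //; exact: bounded_rv_cst.
Qed.

Lemma bounded_rv_indic (A : set T) : measurable A -> bounded_rv (\1_A : T -> R).
Proof.
move=> mA; split; first exact: measurable_indic.
by exists 1 => w; rewrite indicE; case: (_ \in _); rewrite ?normr0 ?normr1.
Qed.

Lemma bounded_rv_sum n (F : nat -> T -> R) : (forall k, bounded_rv (F k)) ->
  bounded_rv (fun w => \sum_(k < n) F k w).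
Proof.
move=> bF; elim: n => [|n IH].
  rewrite (_ : (fun _ => _) = cst 0); first exact: bounded_rv_cst.
  by apply/funext => w; rewrite big_ord0.
rewrite (_ : (fun _ => _) = (fun w => \sum_(k < n) F k w) \+ F n).
  exact: bounded_rvD.
by apply/funext => w; rewrite big_ord_recr.
Qed.

Lemma bounded_rv_homo (f : R -> R) X (a b : R) : {homo f : x y / x <= y} ->
  measurable_fun setT X -> (forall w, a <= X w <= b) -> bounded_rv (f \o X).
Proof.
move=> hf mX abX; split.
  apply: measurableT_comp => //; exact: nondecreasing_measurable.
exists (`|f a| + `|f b|) => w /=; have /andP[aX Xb] := abX w.
rewrite ler_norml (le_trans _ (hf _ _ aX)) ?(le_trans (hf _ _ Xb))//.
  by rewrite (le_trans (ler_norm _))// lerDr.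
by rewrite lerNl (le_trans (ler_norm _))// normrN lerDl.
Qed.

Lemma le_Expect X Y : bounded_rv X -> bounded_rv Y ->
  (forall w, X w <= Y w) -> \int[P]_w X w <= \int[P]_w Y w.
Proof.
by move=> bX bY XY; apply: le_Rintegral => //; exact: bounded_rv_integrable.
Qed.

Lemma ExpectD X Y : bounded_rv X -> bounded_rv Y ->
  \int[P]_w (X w + Y w) = \int[P]_w X w + \int[P]_w Y w.
Proof. by move=> bX bY; rewrite RintegralD//; exact: bounded_rv_integrable. Qed.

Lemma ExpectB X Y : bounded_rv X -> bounded_rv Y ->
  \int[P]_w (X w - Y w) = \int[P]_w X w - \int[P]_w Y w.
Proof. by move=> bX bY; rewrite RintegralB//; exact: bounded_rv_integrable. Qed.

Lemma ExpectZ (c : R) X : bounded_rv X ->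
  \int[P]_w (c * X w) = c * \int[P]_w X w.
Proof. by move=> bX; rewrite RintegralZl//; exact: bounded_rv_integrable. Qed.

Lemma Expect_cst (c : R) : \int[P]_w c = c.
Proof. by rewrite Rintegral_cst// -[fine _]/(fine (P setT)) probability_setT mulr1. Qed.

Lemma Expect_indic (A : set T) : measurable A -> \int[P]_w \1_A w = fine (P A).
Proof. by move=> mA; rewrite /Rintegral integral_indic// setIT. Qed.

Lemma expectationE X : bounded_rv X -> 'E_P[X]%E = (\int[P]_w X w)%:E.
Proof.
move=> bX; rewrite unlock fineK//; apply: integrable_fin_num => //.
exact: bounded_rv_integrable.
Qed.

Lemma bounded_expectation_exists X : bounded_rv X -> expectation_exists P X.
Proof.
move=> bX; left.
have := integrable_pos_fin_num measurableT (bounded_rv_integrable bX).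
by rewrite ge0_fin_numE// integral_ge0.
Qed.

(** Layer-cake argument: up to an error [1 / n], the weight [W] is [1 / n] times the sum of the
    indicators of [k / n < W], and each of these contributes a nonnegative expectation. *)
Lemma Expect_weight_ge0 H W : bounded_rv H -> bounded_rv W ->
    (forall w, 0 <= W w) ->
    (forall t, 0 <= t -> 0 <= \int[P]_w (H w * \1_[set w | t < W w] w)) ->
  0 <= \int[P]_w (H w * W w).
Proof.
move=> bH bW W0 HW.
have [mW [M WM]] := bW; have [mH [N HN]] := bH.
have mset t : measurable [set w | t < W w].
  rewrite -[X in measurable X]setTI.
  have := mW measurableT `]t, +oo[%classic (measurable_itv _).
  by congr measurable; congr (_ `&` _); apply: eq_set => w /=; rewrite in_itv/= andbT.
have N0 : 0 <= N by apply: le_trans (HN point).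
have M0 : 0 <= M by apply: le_trans (WM point).
apply/ler_addgt0Pr => e e0.
(* The discretisation error is at most [N / n], hence at most [e]; [K] levels suffice to cover the
   range of [W]. *)
pose n := (Num.bound (N / e)).+1; pose K := Num.bound (M * n%:R).
have n0 : 0 < n%:R :> R by rewrite ltr0n.
pose F k : T -> R := H \* \1_[set w | k%:R / n%:R < W w].
have bF k : bounded_rv (F k).
  by apply: bounded_rvM => //; exact: bounded_rv_indic.
have EF m : 0 <= \int[P]_w \sum_(k < m) F k w.
  elim: m => [|m IH].
    by apply: Rintegral_ge0 => w _; rewrite big_ord0.
  under eq_Rintegral do rewrite big_ord_recr/=.
  rewrite ExpectD ?addr_ge0//; last exact: bounded_rv_sum.
  by apply: HW; rewrite divr_ge0.
have bHW := bounded_rvM bH bW.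
have : \int[P]_w (n%:R^-1 * \sum_(k < K) F k w)
    <= \int[P]_w (H w * W w + e).
  apply: (@le_Expect (cst n%:R^-1 \* (fun w => \sum_(k < K) F k w))
    ((H \* W) \+ cst e)) => /=.
  - apply: bounded_rvM; [exact: bounded_rv_cst|exact: bounded_rv_sum].
  - by apply: bounded_rvD => //; exact: bounded_rv_cst.
  move=> w; have := @step_approx R K (W w * n%:R).
  have -> : \sum_(k < K) F k w
      = H w * \sum_(k < K) (k%:R < W w * n%:R)%R%:R.
    rewrite mulr_sumr; apply: eq_bigr => k _; rewrite /F/= indicE.
    by rewrite -ltr_pdivrMr//; congr (_ * (nat_of_bool _)%:R); apply/idP/idP;
      rewrite inE.
  rewrite mulr_ge0// => /(_ _)/wrap[].
    apply: (@le_trans _ _ (M * n%:R)).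
      by rewrite ler_pM2r// (le_trans (ler_norm _)).
    by apply/ltW/archi_boundP; exact: mulr_ge0.
  set s := \sum_(k < K) _ => /andP[s1 s2].
  rewrite -(ler_pM2l n0) mulVKf ?gt_eqF//.
  have : H w * (s - W w * n%:R) <= N.
    apply: (le_trans (ler_norm _)); rewrite normrM -[N]mulr1.
    by apply: ler_pM => //; rewrite ger0_norm; lra.
  have : N <= n%:R * e.
    rewrite -ler_pdivrMr// ltW//.
    have := archi_boundP (divr_ge0 N0 (ltW e0)).
    by move=> /lt_trans; apply; rewrite ltr_nat.
  by rewrite mulrBr; lra.
have bS := bounded_rv_sum K bF.
rewrite ExpectZ// ExpectD ?Expect_cst//; last exact: bounded_rv_cst.
by apply: le_trans; rewrite mulr_ge0.
Qed.

End BoundedVariables.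

(** * Expectations of functions of a uniform variable *)

Section Clamp.
Context (R : realType).
Implicit Types (f : R -> R) (x : R).

Lemma clamp01_homo : {homo @clamp01 R : x y / x <= y}.
Proof. by move=> x y xy; rewrite /clamp01 !le_min !ge_min !le_max !ge_max; lra. Qed.

Lemma clamp01_bounds x : 0 <= clamp01 x <= 1.
Proof. by rewrite /clamp01 le_min ge_min le_max ler01 !lexx !orbT. Qed.

Lemma clamp01_in x : clamp01 x \in `[0, 1].
Proof. by rewrite in_itv/= clamp01_bounds. Qed.

Lemma clamp01_id x : 0 <= x <= 1 -> clamp01 x = x.
Proof. by move=> /andP[x0 x1]; rewrite /clamp01 max_l// min_l. Qed.

Lemma clamp01_le x (v : R) : 0 <= v -> x <= v -> clamp01 x <= v.
Proof. by move=> v0 xv; rewrite /clamp01 ge_min ge_max xv v0. Qed.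

Lemma clamp01_ge x (v : R) : v <= 1 -> v <= x -> v <= clamp01 x.
Proof. by move=> v1 vx; rewrite /clamp01 le_min le_max vx v1. Qed.

Lemma increasing01_clamp_homo f : increasing01 f ->
  {homo f \o @clamp01 R : x y / x <= y}.
Proof.
move=> [_ hf] x y xy; apply: (hf _ _ (clamp01_in _) (clamp01_in _)).
exact: clamp01_homo.
Qed.

Lemma increasing01_clamp_bounds f x : increasing01 f ->
  0 <= f (clamp01 x) <= f 1.
Proof.
move=> [f0 hf]; rewrite f0 ?clamp01_in//=.
have /andP[_ x1] := clamp01_bounds x.
by apply: hf; rewrite ?clamp01_in// in_itv/= ler01 lexx.
Qed.

Lemma increasing01_id : increasing01 (@id R).
Proof. by split=> // x; rewrite in_itv/= => /andP[]. Qed.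

Lemma integral_id (v : R) : 0 <= v ->
  \int[lebesgue_measure]_(u in `[0, v]) u = v ^+ 2 / 2.
Proof.
rewrite le_eqVlt => /predU1P[<-|v0].
  by rewrite set_itv1 Rintegral_set1 expr0n/= mul0r.
pose F := fun x : R => x ^+ 2 / 2.
have dF x : is_derive x 1 (F : R -> R^o) x.
  by apply: is_derive_eq; rewrite /GRing.scale/=; field.
have := @continuous_FTC2 R id (F : R -> R^o) 0 v v0.
rewrite /Rintegral => -> /=.
- by rewrite /F; lra.
- by apply: continuous_subspaceT => x; exact: cvg_id.
- have cF x : {for x, continuous F}.
    by apply: differentiable_continuous; apply/derivable1_diffP.
  by split=> [x _||]; 
    [|apply: cvg_at_right_filter; exact: cF|apply: cvg_at_left_filter; exact: cF].
- by move=> x _; rewrite derive1E derive_val.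
Qed.

End Clamp.

Section UniformVariable.
Context (R : realType) (d : measure_display) (T : measurableType d).
Variables (P : probability T R) (U : {RV P >-> R}).
Hypothesis unifU : uniform01 U.

Lemma integral_uniform01 (f : R -> R) : measurable_fun setT f ->
  (forall x, 0 <= f x) ->
  (\int[P]_w (f (U w))%:E = \int[lebesgue_measure]_(x in `[0%R, 1%R]) (f x)%:E)%E.
Proof.
move=> mf f0.
rewrite -[LHS](@ge0_integral_distribution _ _ _ _ _ P U (EFin \o f))//; last first.
  exact/measurable_EFinP.
pose idTR : measurableTypeR R -> R := idfun.
have mid : measurable_fun setT idTR by exact: measurable_id.
pose V : {mfun measurableTypeR R >-> R} :=
  HB.pack idTR (isMeasurableFun.Build _ _ _ _ idTR mid).
rewrite (@eq_measure_integral _ _ _ _ (distribution (uniform_prob (@ltr01 R)) V)).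
  rewrite ge0_integral_distribution//; last exact/measurable_EFinP.
  rewrite integral_uniform//; last exact/measurable_EFinP.
  by rewrite subr0 invr1 mul1e.
by move=> A mA _; exact: unifU.
Qed.

(** Clamping makes [f] monotone on the whole line, hence measurable, although nothing is known of
    [f] outside [0,1]. *)
Lemma Expect_uniform01 (f : R -> R) (D : set R) : increasing01 f ->
  measurable D ->
  \int[P]_w (f (clamp01 (U w)) * \1_D (U w)) =
  \int[lebesgue_measure]_(u in `[0, 1] `&` D) f u.
Proof.
move=> incf mD; congr fine.
have hf := increasing01_clamp_homo incf.
rewrite (@integral_uniform01 (fun u => f (clamp01 u) * \1_D u)).
- rewrite [RHS]integral_mkcondr; apply: eq_integral => u.
  rewrite inE/= => u01; rewrite patchE indicE clamp01_id//.
  by case: ifPn => uD; rewrite ?mulr1// mulr0.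
- apply: measurable_funM; last exact: measurable_indic.
  exact: (nondecreasing_measurable _ hf).
- move=> u; rewrite mulr_ge0//.
  by have /andP[] := increasing01_clamp_bounds u incf.
Qed.

(** A uniform variable leaves [0,1] only on a null event. Clamping it makes its image under a
    monotone function bounded everywhere. *)
Lemma expectation_clamp01 (phi : R -> R) : measurable_fun setT phi ->
  'E_P[phi \o U]%E = 'E_P[phi \o @clamp01 R \o U]%E.
Proof.
move=> mphi; rewrite unlock; apply: ae_eq_integral => //.
- by apply/measurable_EFinP; exact: measurableT_comp.
- apply/measurable_EFinP; apply: measurableT_comp => //.
  apply: measurableT_comp => //; apply: nondecreasing_measurable => //.
  exact: clamp01_homo.
exists (U @^-1` ~` `[0, 1]); split.
- by rewrite -[X in measurable X]setTI; apply: measurable_funPT => //; exact: measurableC.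
- transitivity (uniform_prob (@ltr01 R) (~` `[0, 1]%classic)).
    by apply: unifU; exact: measurableC.
  by rewrite /uniform_prob integral_uniform_pdf setICl integral_set0.
- by move=> w /= nw Uw; apply: nw => _; rewrite clamp01_id.
Qed.

End UniformVariable.

(** * Initial segments of the unit interval *)

Section InitialSegments.
Context (R : realType).
Implicit Types (f : R -> R) (D : set R).

(** The endpoint is the supremum of [D], attained or not; the empty set is the half-open segment
    with [s = 0]. *)
Lemma initial_segment D : D `<=` `[0, 1] ->
    (forall x y, 0 <= x -> x <= y -> D y -> D x) ->
  exists2 s : R, 0 <= s <= 1 & D = `[0, s]%classic \/ D = `[0, s[%classic.
Proof.
move=> D01 downD; have [D0|nD0] := pselect (D 0); last first.
  exists 0; rewrite ?lexx ?ler01//; right.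
  rewrite set_itvco0; apply/seteqP; split=> // x Dx; apply: nD0.
  by apply: (downD _ _ _ _ Dx) => //; have := D01 _ Dx; rewrite /= in_itv/= => /andP[].
have ubD : ubound D 1.
  by move=> x /D01; rewrite /= in_itv/= => /andP[].
have supD : has_sup D by split; [exists 0|exists 1].
have le_sup x : D x -> x <= sup D by move=> Dx; apply: ub_le_sup => //; exists 1.
have lt_sup x : 0 <= x -> x < sup D -> D x.
  rewrite -subr_gt0 => x0 xs; have [y Dy] := sup_adherent xs supD.
  by rewrite subKr => /ltW xy; exact: downD Dy.
have D_ge0 x : D x -> 0 <= x by move=> /D01; rewrite /= in_itv/= => /andP[].
exists (sup D); first by rewrite le_sup// ge_sup//; exists 0.
have [Ds|nDs] := pselect (D (sup D)); [left|right].
  apply/seteqP; split=> x /=; rewrite in_itv/=.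
    by move=> Dx; rewrite D_ge0// le_sup.
  by move=> /andP[x0 xs]; exact: downD Ds.
apply/seteqP; split=> x /=; rewrite in_itv/=.
  move=> Dx; rewrite D_ge0//= lt_neqAle le_sup// andbT.
  by apply/eqP => xs; apply: nDs; rewrite -xs.
by move=> /andP[]; exact: lt_sup.
Qed.

Lemma increasing01_measurable f D : increasing01 f -> measurable D ->
  D `<=` `[0, 1] -> measurable_fun D f.
Proof.
move=> incf mD D01; apply: (eq_measurable_fun (f \o @clamp01 R)).
  by move=> x; rewrite inE => /D01 /= x01; rewrite clamp01_id//.
by apply: nondecreasing_measurable => //; exact: increasing01_clamp_homo.
Qed.

Lemma Rintegral_increasing01_co f (s : R) : increasing01 f -> 0 <= s <= 1 ->
  \int[lebesgue_measure]_(u in `[0, s[) f u =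
  \int[lebesgue_measure]_(u in `[0, s]) f u.
Proof.
move=> incf /andP[s0 s1]; rewrite /Rintegral integral_itv_bndo_bndc//.
apply/measurable_EFinP; apply: (increasing01_measurable incf) => // x /=.
by rewrite !in_itv/= => /andP[-> /ltW xs]; exact: le_trans s1.
Qed.

End InitialSegments.

Section UniformExpectations.
Context (R : realType) (d : measure_display) (T : measurableType d).
Variables (P : probability T R) (U : {RV P >-> R}).
Hypothesis unifU : uniform01 U.
Implicit Types (f phi : R -> R).

Lemma measurable_clamp01 (X : T -> R) : measurable_fun setT X ->
  measurable_fun setT (@clamp01 R \o X).
Proof.
by apply: measurableT_comp; apply: nondecreasing_measurable => //;
  exact: clamp01_homo.
Qed.

Lemma measurable_increasing01_clamp f (X : T -> R) : increasing01 f ->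
  measurable_fun setT X -> measurable_fun setT (f \o @clamp01 R \o X).
Proof.
move=> incf; apply: (@measurableT_comp _ _ _ _ _ _ (f \o @clamp01 R)).
by apply: nondecreasing_measurable => //; exact: increasing01_clamp_homo.
Qed.

Lemma bounded_rv_clamp01 phi (X : T -> R) : {homo phi : x y / x <= y} ->
  measurable_fun setT X -> bounded_rv (phi \o @clamp01 R \o X).
Proof.
move=> hphi mX; apply: (@bounded_rv_homo _ _ _ phi (@clamp01 R \o X) 0 1) => //.
  exact: measurable_clamp01.
by move=> w; exact: clamp01_bounds.
Qed.

Lemma bounded_rv_increasing01 phi f (X : T -> R) :
  {homo phi : x y / x <= y} -> increasing01 f ->
  measurable_fun setT X -> bounded_rv (phi \o f \o @clamp01 R \o X).
Proof.
move=> hphi incf mX.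
apply: (@bounded_rv_homo _ _ _ phi (f \o @clamp01 R \o X) 0 (f 1)) => //.
  exact: measurable_increasing01_clamp.
by move=> w; exact: increasing01_clamp_bounds.
Qed.

Lemma Expect_uniform01_le f (v : R) : increasing01 f -> 0 <= v <= 1 ->
  \int[P]_w (f (clamp01 (U w)) * \1_`]-oo, v] (U w)) =
  \int[lebesgue_measure]_(u in `[0, v]) f u.
Proof.
move=> incf /andP[v0 v1]; rewrite Expect_uniform01//; congr Rintegral.
apply/seteqP; split=> u /=; rewrite !in_itv/=.
  by move=> [/andP[-> _] ->].
by move=> /andP[-> uv]; rewrite uv (le_trans uv).
Qed.

(** The supergradient at [f V] bounds [phi (f V) - phi V] below by [(f V - V) * g (f V)]. The
    superlevel sets of this weight are initial segments in [V], where the hypothesis compares the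
    integral of [f] with that of the identity. *)
Lemma le_Expect_concave f phi : increasing01 f ->
    (forall v, 0 <= v <= 1 ->
      v ^+ 2 / 2 <= \int[lebesgue_measure]_(u in `[0, v]) f u) ->
    {homo phi : x y / x <= y} -> concave_fun phi ->
  \int[P]_w phi (clamp01 (U w)) <= \int[P]_w phi (f (clamp01 (U w))).
Proof.
move=> incf intf hphi cphi.
have [g [g0 hg sg]] := concave_supergradient hphi cphi.
have mU : measurable_fun setT U by exact: measurable_funPT.
have hid : {homo @id R : x y / x <= y} by [].
pose V w := clamp01 (U w).
have bV : bounded_rv V := bounded_rv_clamp01 hid mU.
have bfV : bounded_rv (f \o V) := bounded_rv_increasing01 hid incf mU.
have bphiV : bounded_rv (phi \o V) := bounded_rv_clamp01 hphi mU.
have bphifV : bounded_rv (phi \o (f \o V)) :=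
  bounded_rv_increasing01 hphi incf mU.
(* [g] is decreasing, so its boundedness along [f V] is obtained from its opposite. *)
have hNg : {homo -%R \o g : x y / x <= y} by move=> x y xy; rewrite /= lerN2 hg.
have bW : bounded_rv (g \o (f \o V)).
  have bNg := bounded_rv_increasing01 hNg incf mU.
  rewrite (_ : g \o _ = cst (- 1) \* (-%R \o g \o f \o @clamp01 R \o U)).
    by apply: bounded_rvM => //; exact: bounded_rv_cst.
  by apply/funext => w /=; rewrite mulN1r opprK.
have bH : bounded_rv ((f \o V) \- V) by exact: bounded_rvB.
have : 0 <= \int[P]_w ((f (V w) - V w) * g (f (V w))).
  apply: (@Expect_weight_ge0 _ _ _ P ((f \o V) \- V) (g \o (f \o V))) => //.
    by move=> w; exact: g0.
  move=> t t0; pose D := [set u | t < g (f (clamp01 u))].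
  have downD x y : x <= y -> D y -> D x.
    rewrite /D /= => xy /lt_le_trans; apply; apply: hg.
    exact: (increasing01_clamp_homo incf).
  have mD : measurable D.
    apply: is_interval_measurable => x y Dx Dy z /andP[xz zy].
    exact: downD Dy.
  have -> : \int[P]_w (((f \o V) \- V) w * \1_[set w | t < (g \o (f \o V)) w] w)
      = \int[P]_w (f (V w) * \1_D (U w) - V w * \1_D (U w)).
    by apply: eq_Rintegral => w _; rewrite /= mulrBl.
  have b1D : bounded_rv ((\1_D : R -> R) \o U).
    apply: (@bounded_rv_indic _ _ _ (U @^-1` D)).
  by rewrite -[X in measurable X]setTI; exact: mU.
  rewrite (@ExpectB _ _ _ P ((f \o V) \* (\1_D \o U)) (V \* (\1_D \o U))).
  - rewrite /= /V (Expect_uniform01 unifU incf mD).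
    rewrite (Expect_uniform01 unifU (@increasing01_id R) mD) subr_ge0.
    have [|x y x0 xy|s s01 Is] := @initial_segment R (`[0, 1] `&` D).
    + exact: subIsetl.
    + move=> [/=]; rewrite !in_itv/= x0 => /andP[y0 y1] Dy.
      by split; [exact: le_trans y1|exact: downD Dy].
    + have /andP[s0 _] := s01.
      by case: Is => ->; rewrite ?Rintegral_increasing01_co// ?integral_id// ?intf//;
        exact: increasing01_id.
  - exact: bounded_rvM.
  - exact: bounded_rvM.
have le w : (f (V w) - V w) * g (f (V w)) <= phi (f (V w)) - phi (V w).
  by have := sg (V w) (f (V w)); lra.
have := @le_Expect _ _ _ P (((f \o V) \- V) \* (g \o (f \o V)))
  ((phi \o (f \o V)) \- (phi \o V)).
rewrite ExpectB//= => /(_ _ _ le); rewrite -/V => H1 H2.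
by have := H1 (bounded_rvM bH bW) (bounded_rvB bphifV bphiV); lra.
Qed.

(** The integrand is [U - v] on the event [U <= v] and 0 elsewhere, which gives
    [v ^+ 2 / 2 - v * v]. *)
Lemma Expect_min_uniform01 (v : R) : 0 <= v <= 1 ->
  \int[P]_w Num.min (clamp01 (U w) - v) 0 = - (v ^+ 2 / 2).
Proof.
move=> /[dup] v01 /andP[v0 v1].
pose D : set R := `]-oo, v]%classic.
have mD : measurable D by exact: measurable_itv.
have mU : measurable_fun setT U by exact: measurable_funPT.
have bV : bounded_rv (@clamp01 R \o U).
  by apply: (@bounded_rv_clamp01 id).
have b1D : bounded_rv ((\1_D : R -> R) \o U).
  apply: (@bounded_rv_indic _ _ _ (U @^-1` D)).
  by rewrite -[X in measurable X]setTI; exact: mU.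
have -> : \int[P]_w Num.min (clamp01 (U w) - v) 0 =
    \int[P]_w (clamp01 (U w) * \1_D (U w) - v * \1_D (U w)).
  apply: eq_Rintegral => w _; rewrite indicE.
  have [Uv|vU] := leP (U w) v.
    rewrite mem_set ?mulr1; last by rewrite /D /= in_itv.
    by rewrite min_l// subr_le0 clamp01_le.
  rewrite memNset ?mulr0 ?subr0; last by rewrite /D /= in_itv/= leNgt vU.
  by rewrite min_r// subr_ge0 clamp01_ge// ltW.
rewrite (@ExpectB _ _ _ P ((@clamp01 R \o U) \* (\1_D \o U)) (cst v \* (\1_D \o U)));
  [|exact: bounded_rvM|by apply: bounded_rvM => //; exact: bounded_rv_cst].
rewrite /= (@ExpectZ _ _ _ P v (\1_D \o U))//=.
rewrite (Expect_uniform01_le (@increasing01_id R))// integral_id//.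
have -> : \int[P]_w \1_D (U w) = v.
  rewrite -[LHS]/(\int[P]_w \1_(U @^-1` D) w) Expect_indic; last first.
    by rewrite -[X in measurable X]setTI; exact: mU.
  have -> : U @^-1` D = [set w | U w <= v].
    by apply: eq_set => w; rewrite /D /= in_itv.
  by rewrite -[fine _]/(fine (P [set w | U w <= v])) (uniform01_cdf unifU).
lra.
Qed.

End UniformExpectations.

(** * Calibrators *)

Section Calibrators.
Context (R : realType) (d : measure_display) (T : measurableType d).
Variable P : probability T R.
Implicit Types (f g phi : R -> R) (U : {RV P >-> R}).

Lemma homo_min_sub (c : R) : {homo (fun x : R => Num.min (x - c) 0) : x y / x <= y}.
Proof. by move=> x y xy; rewrite le_min !ge_min lexx orbT lerB// andbT. Qed.

Lemma concave_min_sub (c : R) : concave_fun (fun x : R => Num.min (x - c) 0).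
Proof.
move=> t x y _ _; rewrite !convRE/= /unstable.onem.
rewrite -[X in - Num.min (X - c) 0 <= _]/(t%:num * x + (1 - t%:num) * y).
have t0 : 0 <= t%:num by []; have t1 : t%:num <= 1 by [].
move: (t%:num) t0 t1 => s s0 s1.
rewrite lerNl le_min; apply/andP; split.
  have := ler_wpM2l s0 (_ : Num.min (x - c) 0 <= x - c).
  have := ler_wpM2l (_ : 0 <= 1 - s) (_ : Num.min (y - c) 0 <= y - c).
  by rewrite !ge_min !lexx subr_ge0 s1 => /(_ isT isT) + /(_ isT); lra.
have := ler_wpM2l s0 (_ : Num.min (x - c) 0 <= 0).
have := ler_wpM2l (_ : 0 <= 1 - s) (_ : Num.min (y - c) 0 <= 0).
by rewrite !ge_min !lexx !orbT subr_ge0 s1 => /(_ isT isT) + /(_ isT); lra.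
Qed.

Lemma bounded_rv_ray U (v : R) : bounded_rv ((\1_`]-oo, v] : R -> R) \o U).
Proof.
apply: (@bounded_rv_indic _ _ _ (U @^-1` `]-oo, v]%classic)).
exact: measurable_funPTI.
Qed.

Lemma indic_ray (x v : R) : \1_`]-oo, v] x = (x <= v)%R%:R :> R.
Proof.
by rewrite indicE; congr (nat_of_bool _)%:R; apply/idP/idP; rewrite inE/= in_itv.
Qed.

Lemma Expect_ray U (v : R) : uniform01 U -> 0 <= v <= 1 ->
  \int[P]_w \1_`]-oo, v] (U w) = v.
Proof.
move=> unifU v01.
rewrite -[LHS]/(\int[P]_w \1_(U @^-1` `]-oo, v]%classic) w).
rewrite Expect_indic; last exact: measurable_funPTI.
have -> : U @^-1` `]-oo, v]%classic = [set w | U w <= v].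
  by apply: eq_set => w; rewrite /= in_itv.
by rewrite -[fine _]/(fine (P [set w | U w <= v])) (uniform01_cdf unifU).
Qed.

Lemma Expect_uniform01T U f : uniform01 U -> increasing01 f ->
  \int[P]_w f (clamp01 (U w)) = \int[lebesgue_measure]_(u in `[0, 1]) f u.
Proof.
move=> unifU incf; rewrite -[in RHS](setIT `[0, 1]%classic).
rewrite -(Expect_uniform01 unifU incf measurableT).
by apply: eq_Rintegral => w _; rewrite indicT/= mulr1.
Qed.

(** The test function is nonpositive, so its expectation exists for every [X], bounded or not. *)
Lemma pstar_min_expectation (X : T -> R) (v : R) : pstar_variable P X ->
  0 <= v <= 1 -> ((- (v ^+ 2 / 2))%:E <= 'E_P[(fun w => Num.min (X w - v) 0)%R])%E.
Proof.
move=> [mX [U [unifU UX]]] v01.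
have mmin := nondecreasing_measurable measurableT (@homo_min_sub v).
have mU : measurable_fun setT U by exact: measurable_funPT.
have bU := @bounded_rv_clamp01 _ _ _ _ U (@homo_min_sub v) mU.
have ex (Y : T -> R) :
    expectation_exists P ((fun x : R => Num.min (x - v) 0) \o Y).
  left; rewrite integral0_eq ?ltry// => w _.
  by rewrite funeposE max_r// lee_fin ge_min lexx orbT.
have := UX _ (@homo_min_sub v) (@concave_min_sub v) (ex U) (ex X).
apply: le_trans; rewrite (expectation_clamp01 unifU mmin) expectationE//=.
by rewrite (Expect_min_uniform01 unifU).
Qed.

(** Pointwise, [min (f U - v) 0] plus [v] times the indicator of [U <= v] is at most [f U] times
    that indicator, and the left side has expectation at least [- v ^+ 2 / 2 + v * v]. *)
Lemma Expect_min_integral f U (v : R) : uniform01 U -> increasing01 f ->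
    0 <= v <= 1 ->
    - (v ^+ 2 / 2) <= \int[P]_w Num.min (f (clamp01 (U w)) - v) 0 ->
  v ^+ 2 / 2 <= \int[lebesgue_measure]_(u in `[0, v]) f u.
Proof.
move=> unifU incf v01 Emin.
have mU : measurable_fun setT U by exact: measurable_funPT.
have bfU := @bounded_rv_increasing01 _ _ _ id f U (fun _ _ => id) incf mU.
have bmin := @bounded_rv_increasing01 _ _ _ _ f U (@homo_min_sub v) incf mU.
have bray := bounded_rv_ray U v.
have bvray := bounded_rvM (bounded_rv_cst T v) bray.
rewrite -(Expect_uniform01_le unifU)//.
have := @le_Expect _ _ _ P _ _ (bounded_rvD bmin bvray) (bounded_rvM bfU bray).
rewrite /= ExpectD//= (@ExpectZ _ _ _ P v _ bray)/= Expect_ray//.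
move=> /(_ _)/wrap[|]; last by move: Emin; lra.
move=> w; rewrite indic_ray; case: (U w <= v)%R; rewrite /= ?mulr1 ?mulr0.
  by rewrite -lerBrDr ge_min lexx.
by rewrite addr0 ge_min lexx orbT.
Qed.

(** A uniform variable is itself a p-variable. The shortfall bound is kept beside the integral bound
    because truncating [f] at a level above [v] leaves it unchanged. *)
Lemma p_to_pstar_integral f (v : R) : (exists U, uniform01 U) ->
    p_to_pstar_calibrator P f -> 0 <= v <= 1 ->
  v ^+ 2 / 2 <= \int[lebesgue_measure]_(u in `[0, v]) f u /\
  forall U, uniform01 U ->
    - (v ^+ 2 / 2) <= \int[P]_w Num.min (f (clamp01 (U w)) - v) 0.
Proof.
move=> [U0 unif0] [incf calf] v01.
have Emin U : uniform01 U ->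
    - (v ^+ 2 / 2) <= \int[P]_w Num.min (f (clamp01 (U w)) - v) 0.
  move=> unifU; have mU : measurable_fun setT U by exact: measurable_funPT.
  have /calf pstarf : p_variable P U by split=> //; exists U; split=> // phi.
  have bmin := @bounded_rv_increasing01 _ _ _ _ f U (@homo_min_sub v) incf mU.
  by have := pstar_min_expectation pstarf v01; rewrite (expectationE P bmin).
by split=> //; exact: Expect_min_integral (Emin _ unif0).
Qed.

(** Two comparisons are chained: [U] against [f U] by concavity, then [f U] against [f X] because
    [phi] composed with the clamped [f] is an increasing test function for the first order. *)
Lemma integral_p_to_pstar f : increasing01 f ->
    (forall v, 0 <= v <= 1 ->
      v ^+ 2 / 2 <= \int[lebesgue_measure]_(u in `[0, v]) f u) ->
  p_to_pstar_calibrator P f.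
Proof.
move=> incf intf; split=> // X [mX [U [unifU UX]]].
split; first exact: measurable_increasing01_clamp.
exists U; split=> // phi hphi cphi _ _.
have mphi := nondecreasing_measurable measurableT hphi.
have mU : measurable_fun setT U by exact: measurable_funPT.
have bX := bounded_rv_increasing01 hphi incf mX.
have bU := bounded_rv_increasing01 hphi incf mU.
rewrite (expectation_clamp01 unifU mphi).
apply: (@le_trans _ _ 'E_P[phi \o f \o @clamp01 R \o U]%E).
  rewrite !expectationE ?lee_fin//; last exact: bounded_rv_clamp01.
  exact: (le_Expect_concave unifU incf intf hphi cphi).
apply: (UX (phi \o f \o @clamp01 R)).
- by move=> x y xy; apply: hphi; exact: (increasing01_clamp_homo incf).
- exact: bounded_expectation_exists.
- exact: bounded_expectation_exists.
Qed.

End Calibrators.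

(** * The optimal p*-to-p calibrator *)

Section PstarToP.
Context (R : realType) (d : measure_display) (T : measurableType d).
Variable P : probability T R.
Implicit Types (X : T -> R) (U : {RV P >-> R}).

Lemma measurable_le_set X (a : R) : measurable_fun setT X ->
  measurable [set w | X w <= a].
Proof.
move=> mX; rewrite [X in measurable X](_ : _ = setT `&` X @^-1` `]-oo, a]%classic).
  exact: mX.
by rewrite setTI; apply: eq_set => w; rewrite /= in_itv.
Qed.

(** Markov's inequality bounds the probability of [X <= x] by [c ^+ 2 / (2 * (c - x))], which is
    smallest at [c = 2 * x]; hence the threshold [a / 2] for the test level [a]. *)
Lemma pstar_half_tail X (a : R) : pstar_variable P X -> 0 < a <= 1 ->
  (P [set w | (X w <= a / 2)%R] <= a%:E)%E.
Proof.
move=> pX /andP[a0 a1]; have [mX _] := pX.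
have := pstar_min_expectation pX (_ : 0 <= a <= 1); rewrite (ltW a0) => /(_ a1).
have mA := measurable_le_set (a / 2) mX.
rewrite unlock; set mn := fun w => Num.min (X w - a) 0.
have mn0 w : mn w <= 0 by rewrite ge_min lexx orbT.
have mmn : measurable_fun setT mn.
  exact: (measurableT_comp (nondecreasing_measurable measurableT (@homo_min_sub R a))).
have -> : (\int[P]_w (mn w)%:E = - \int[P]_w (- mn w)%:E)%E.
  rewrite -integral_ge0N; last by move=> w _; rewrite lee_fin oppr_ge0.
  by apply: eq_integral => w _; rewrite EFinN oppeK.
rewrite EFinN leeN2 => Emn.
have : ((a / 2)%:E * P [set w | (X w <= a / 2)%R] <= (a ^+ 2 / 2)%:E)%E.
  apply: le_trans Emn; have -> : P [set w | X w <= a / 2] =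
      (\int[P]_w (\1_[set w | (X w <= a / 2)%R] w)%:E)%E.
    by rewrite integral_indic// setIT.
  rewrite -ge0_integralZl//; last 2 first.
  - exact/measurable_EFinP/measurable_indic.
  - by rewrite lee_fin divr_ge0// ltW.
  apply: ge0_le_integral => //.
  - by move=> w _; rewrite mule_ge0// lee_fin ?divr_ge0// ltW.
  - apply/measurable_EFinP; apply: measurable_funM => //; exact: measurable_indic.
  - by apply/measurable_EFinP; exact: measurable_funN.
  move=> w _; rewrite -EFinM lee_fin indicE.
  have [Xa|aX] := boolP (w \in _); last by rewrite mulr0 oppr_ge0.
  move: Xa; rewrite inE/= mulr1 lerNr ge_min => Xa; apply/orP; left; lra.
have PE : P [set w | X w <= a / 2] = (fine (P [set w | X w <= a / 2]))%:E.
  by rewrite fineK// fin_num_measure.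
rewrite PE -EFinM !lee_fin => H.
rewrite -(ler_pM2l (_ : 0 < a / 2)) ?divr_gt0//.
by apply: le_trans H _; rewrite expr2 mulrAC.
Qed.

(** Expectations are integrals of tails. A sublevel set of an increasing function on [0,1] is an
    initial segment with some endpoint [s]; [U] falls in it with probability at least [s], and [Y]
    with probability at most [s]. *)
Lemma st_le1_uniform01 U (Y : T -> R) : uniform01 U -> measurable_fun setT Y ->
    (forall w, 0 <= Y w <= 1) ->
    (forall a, 0 <= a < 1 -> (P [set w | (Y w <= a)%R] <= a%:E)%E) ->
  st_le1 P U Y.
Proof.
move=> unifU mY Y01 PY phi hphi _ _.
have mU : measurable_fun setT U by exact: measurable_funPT.
have mphi := nondecreasing_measurable measurableT hphi.
rewrite (expectation_clamp01 unifU mphi).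
(* Subtracting the value at 0 gives a nonnegative function, as the tail formula requires. *)
pose psi x := phi (clamp01 x) - phi 0.
have hpsi : {homo psi : x y / x <= y}.
  by move=> x y xy; rewrite lerD2r hphi// clamp01_homo.
have psi0 x : 0 <= psi x.
  by rewrite subr_ge0 hphi//; have /andP[] := clamp01_bounds x.
have mpsi (X : T -> R) : measurable_fun setT X -> measurable_fun setT (psi \o X).
  exact: measurableT_comp (nondecreasing_measurable measurableT hpsi).
have YE : phi \o Y = phi \o @clamp01 R \o Y.
  by apply/funext => w /=; rewrite clamp01_id.
have psiE (X : T -> R) : measurable_fun setT X ->
    'E_P[phi \o @clamp01 R \o X]%E = ('E_P[psi \o X] + (phi 0)%:E)%E.
  move=> mX; have bX := @bounded_rv_clamp01 _ _ _ phi X hphi mX.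
  have b0 := bounded_rv_cst T (phi 0).
  rewrite (expectationE P bX) (expectationE P (bounded_rvB bX b0)) -EFinD.
  by rewrite ExpectB// Expect_cst subrK.
rewrite YE !psiE//; apply: leeD => //.
pose SU : {mfun T >-> R} :=
  HB.pack (psi \o U) (isMeasurableFun.Build _ _ _ _ (psi \o U) (mpsi _ mU)).
pose SY : {mfun T >-> R} :=
  HB.pack (psi \o Y) (isMeasurableFun.Build _ _ _ _ (psi \o Y) (mpsi _ mY)).
have -> : 'E_P[psi \o U]%E = 'E_P[(SU : {RV P >-> R})]%E by [].
have -> : 'E_P[psi \o Y]%E = 'E_P[(SY : {RV P >-> R})]%E by [].
rewrite !ge0_expectation_ccdf//; last 2 first.
- by move=> w; exact: psi0.
- by move=> w; exact: psi0.
apply: ge0_le_integral => //; [exact: measurable_funTS (ccdf_measurable _)..|].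
move=> t /=; rewrite in_itv/= andbT => t0.
rewrite !ccdf_1_cdf leeD2lE// leeN2.
rewrite /cdf /distribution /pushforward/=.
have -> : (psi \o U) @^-1` `]-oo, t]%classic = [set w | psi (U w) <= t].
  by apply: eq_set => w; rewrite /= in_itv.
have -> : (psi \o Y) @^-1` `]-oo, t]%classic = [set w | psi (Y w) <= t].
  by apply: eq_set => w; rewrite /= in_itv.
have mYt : measurable [set w | psi (Y w) <= t].
  by apply: (@measurable_le_set (psi \o Y)); exact: (mpsi Y mY).
have mUt : measurable [set w | psi (U w) <= t].
  by apply: (@measurable_le_set (psi \o U)); exact: (mpsi U mU).
pose I := `[0, 1] `&` [set x | psi x <= t].
have [|x y x0 xy [y01 yt]|s /andP[s0 s1] Is] := @initial_segment R I.
- exact: subIsetl.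
- split; last exact: le_trans (hpsi _ _ xy) yt.
  by move: y01; rewrite /= !in_itv/= x0 => /andP[_]; exact: le_trans.
(* The endpoint may be missing from the segment, so the bound is proved for [s - e] and [e] is sent
   to 0. *)
have sU : (s%:E <= P [set w | (psi (U w) <= t)%R])%E.
  rewrite -[P _]fineK ?fin_num_measure// lee_fin.
  apply/ler_addgt0Pr => e e0; have [se|es] := leP s e.
    by rewrite (le_trans se)// lerDr fine_ge0.
  have se01 : 0 <= s - e <= 1 by lra.
  rewrite -lerBlDr -lee_fin fineK ?fin_num_measure//.
  rewrite -(uniform01_cdf unifU se01) le_measure ?inE//.
    exact: (@measurable_le_set U).
  move=> w /= Use; have : I (s - e).
    by case: Is => ->; rewrite /= in_itv/=; lra.
  by move=> [_ /=]; apply: le_trans; exact: hpsi.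
apply: le_trans sU; have [slt1|s1'] := ltP s 1; last first.
  by rewrite (le_trans (probability_le1 _ _))// lee_fin.
have [psi1|psi1] := leP (psi 1) t.
  exfalso; have : I 1 by split => //=; rewrite in_itv/= ler01 lexx.
  by case: Is => ->; rewrite /= in_itv/=; lra.
apply: (@le_trans _ _ (P [set w | Y w <= s])); last by apply: PY; rewrite s0.
rewrite le_measure ?inE//; first exact: measurable_le_set.
move=> w /= Yt; have : I (Y w) by split=> //=; rewrite in_itv/=; exact: Y01.
by case: Is => ->; rewrite /= in_itv/= => /andP[_] // /ltW.
Qed.

Lemma double_pstar_to_p : pstar_to_p_calibrator P (fun u : R => Num.min (2 * u) 1).
Proof.
have inc2 : increasing01 (fun u : R => Num.min (2 * u) 1).
  split=> [u|u v _ _ uv].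
    by rewrite in_itv/= => /andP[u0 _]; rewrite le_min ler01 mulr_ge0.
  by rewrite le_min !ge_min lexx orbT andbT; apply/orP; left; lra.
split=> // X pX; have [mX [U [unifU _]]] := pX.
have mY := measurable_increasing01_clamp inc2 mX.
split=> //; exists U; split=> //; apply: st_le1_uniform01 => //.
  move=> w /=; rewrite le_min ler01 ge_min lexx orbT !andbT mulr_ge0//.
  by have /andP[] := clamp01_bounds (X w).
move=> a /andP[a0 a1].
(* The half-tail bound needs a positive level while [a] may be 0; it is applied at [a + e]. *)
have tail e : 0 < e -> a + e <= 1 ->
    (P [set w | (Num.min (2 * clamp01 (X w)) 1 <= a)%R] <= (a + e)%:E)%E.
  move=> e0 ae1; apply: le_trans (pstar_half_tail pX (_ : 0 < a + e <= 1)).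
    rewrite le_measure ?inE//; [exact: (measurable_le_set a mY)|
      exact: measurable_le_set|].
    move=> w /=; rewrite ge_min (leNgt 1) a1 orbF => Va.
    rewrite leNgt; apply/negP => /ltW aX.
    have ae2 : (a + e) / 2 <= 1 by lra.
    by have := clamp01_ge ae2 aX; lra.
  by rewrite ae1 ltr_wpDl.
have mset := measurable_le_set a mY.
rewrite -[P _]fineK ?fin_num_measure// lee_fin.
apply/ler_addgt0Pr => e e0; pose e' := Num.min e (1 - a).
have e'0 : 0 < e' by rewrite lt_min e0 subr_gt0.
have e'e : e' <= e by rewrite ge_min lexx.
have e'a : e' <= 1 - a by rewrite ge_min lexx orbT.
apply: (@le_trans _ _ (a + e')); last by rewrite lerD2l.
by rewrite -lee_fin fineK ?fin_num_measure// tail//; lra.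
Qed.

(* [h] replaces the values below [2 u] by their mean [u]. *)
Lemma flattened_calibrator (u : R) : 0 < u -> u <= 1 / 2 ->
  (exists U, uniform01 U) ->
  p_to_pstar_calibrator P (fun x : R => if x <= 2 * u then u else x).
Proof.
move=> u0 u2 [U unifU]; set h := fun x : R => _.
have inch : increasing01 h.
  split=> [x|x y _ _ xy]; rewrite /h.
    by rewrite in_itv/= => /andP[x0 _]; case: ifP => // _; exact: ltW.
  by case: (leP x); case: (leP y); lra.
apply: integral_p_to_pstar => // v v01; have /andP[v0 v1] := v01.
have mU : measurable_fun setT U by exact: measurable_funPT.
have hid : {homo @id R : x y / x <= y} by [].
have bV := @bounded_rv_clamp01 _ _ _ id U hid mU.
have bhV := @bounded_rv_increasing01 _ _ _ id h U hid inch mU.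
have u01 : 0 <= 2 * u <= 1 by lra.
rewrite -(Expect_uniform01_le unifU inch v01).
(* Below [2 * u] the integral of [h] is [u * v], which is at least [v ^+ 2 / 2]. Beyond it, the loss
   [(2 * u) ^+ 2 / 2] on the flattened part is exactly made up by [u * (2 * u)]. *)
have [vu|uv] := leP v (2 * u).
  apply: (@le_trans _ _ (u * v)).
    by rewrite expr2 mulrAC ler_wpM2r// ler_pdivrMr// mulrC.
  rewrite -[X in u * X](Expect_ray unifU v01) -(ExpectZ P u (bounded_rv_ray U v)).
  apply: le_Expect => [||w]/=.
  - by apply: bounded_rvM (bounded_rv_ray U v); exact: bounded_rv_cst.
  - exact: bounded_rvM bhV (bounded_rv_ray U v).
  rewrite indic_ray; case: (leP _ v) => [Uv|_]; rewrite ?mulr1 ?mulr0//.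
  by rewrite /h ifT// clamp01_le//; lra.
have bu := bounded_rv_ray U (2 * u).
have bucst := bounded_rvM (bounded_rv_cst T u) bu.
have bvV := bounded_rvM bV (bounded_rv_ray U v).
have buV := bounded_rvM bV bu.
have := @le_Expect _ _ _ P _ _ (bounded_rvD (bounded_rvB bvV buV) bucst)
  (bounded_rvM bhV (bounded_rv_ray U v)).
rewrite (@ExpectD _ _ _ P _ _ (bounded_rvB bvV buV) bucst).
rewrite (@ExpectB _ _ _ P _ _ bvV buV) (@ExpectZ _ _ _ P u _ bu)/=.
rewrite (Expect_uniform01_le unifU (@increasing01_id R) v01) integral_id//.
rewrite (Expect_uniform01_le unifU (@increasing01_id R) u01) integral_id; last lra.
rewrite Expect_ray// => /(_ _)/wrap[w|].
  rewrite !indic_ray; case: (leP _ (2 * u)) => Uu; case: (leP _ v) => Uv; rewrite /= ?mulr1 ?mulr0.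
  - by rewrite /h ifT ?clamp01_le//; lra.
  - lra.
  - rewrite /h; case: ifP => [le2u|_]; last lra.
    suff : 2 * u < clamp01 (U w) by lra.
    by rewrite /clamp01 lt_min lt_max Uu/=; lra.
  - lra.
by apply: le_trans; lra.
Qed.

(** The flattened uniform variable equals [u] with probability [2 * u], so [g] of it is at most
    [g u] with at least that probability; being a p-variable, it forces [2 * u <= g u]. *)
Lemma pstar_to_p_ge (g : R -> R) : (exists U, uniform01 U) ->
  pstar_to_p_calibrator P g ->
  dominates_cal (fun u : R => Num.min (2 * u) 1) g.
Proof.
move=> exU [[g0 hg] calg].
suff half u : 0 < u -> u <= 1 / 2 -> 2 * u <= g u.
  move=> u u01; have := u01; rewrite in_itv/= => /andP[u0 u1].
  rewrite ge_min; have [u2|u2] := leP u (1 / 2).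
    move: u0; rewrite le_eqVlt => /predU1P[u0|u0]; last by rewrite half.
    by rewrite -{1}u0 mulr0 g0.
  apply/orP; right; apply: (@le_trans _ _ (g (1 / 2))).
    by have := half (1 / 2) _ _; rewrite lexx divr_gt0// => /(_ isT isT); lra.
  by apply: hg => //; rewrite ?in_itv/=; lra.
move=> u0 u2; have [U unifU] := exU; rewrite leNgt; apply/negP => gu.
have u01 : 0 <= u <= 1 by lra.
have mU : measurable_fun setT U by exact: measurable_funPT.
have pU : p_variable P U by split=> //; exists U; split=> // phi.
have [_ /(_ _ pU)/calg [mZ [U' [unifU' UZ]]]] := flattened_calibrator u0 u2 exU.
move: mZ UZ; set Z := (X in st_le1 P U' X) => mZ UZ.
have gu0 : 0 <= g u by apply: g0; rewrite in_itv.
have gu01 : 0 <= g u <= 1 by lra.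
(* This increasing indicator turns the first order into a comparison of tails at [g u]. *)
pose phi x : R := (g u < x)%R%:R.
have hphi : {homo phi : x y / x <= y}.
  move=> x y xy; rewrite /phi ler_nat; case: ltP => // gx.
  by rewrite (lt_le_trans gx xy).
have mgt (X : T -> R) : measurable_fun setT X -> measurable [set w | g u < X w].
  move=> mX; rewrite [X in measurable X](_ : _ = ~` [set w | X w <= g u]).
    exact/measurableC/measurable_le_set.
  by apply/seteqP; split=> w /=; rewrite ltNge => /negP.
have phiE (X : T -> R) : phi \o X = \1_[set w | g u < X w].
  apply/funext => w; rewrite /phi/= indicE; congr (nat_of_bool _)%:R.
  by apply/idP/idP; rewrite inE.
have mU' : measurable_fun setT U' by exact: measurable_funPT.
have := UZ _ hphi; rewrite !phiE !expectation_indic; [|exact: mgt..].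
have b (X : T -> R) : measurable_fun setT X ->
    expectation_exists P (\1_[set w | g u < X w] : T -> R).
  by move=> mX; apply/bounded_expectation_exists/bounded_rv_indic/mgt.
move=> /(_ (b _ mU') (b _ mZ)).
have PC (X : T -> R) (a : R) : measurable_fun setT X ->
    P [set w | a < X w] = (1 - P [set w | (X w <= a)%R])%E.
  move=> mX; rewrite -probability_setC; last exact: measurable_le_set.
  by congr (P _); apply/seteqP; split=> w /=; rewrite ltNge => /negP.
rewrite PC// (uniform01_cdf unifU')//.
apply/negP; rewrite -ltNge; apply: (@le_lt_trans _ _ (P [set w | 2 * u < U w])).
  rewrite le_measure ?inE//; first exact: mgt.
    rewrite [X in measurable X](_ : _ = ~` [set w | U w <= 2 * u]).
      exact/measurableC/measurable_le_set.
    by apply/seteqP; split=> w /=; rewrite ltNge => /negP.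
  move=> w /=; apply: contraTT; rewrite -!leNgt => U2u.
  by rewrite /Z/= clamp01_le ?clamp01_id//; lra.
rewrite PC// (uniform01_cdf unifU) -?EFinB ?lte_fin//; lra.
Qed.

End PstarToP.

(** * Admissible p-to-p* calibrators *)

Section Admissibility.
Context (R : realType) (d : measure_display) (T : measurableType d).
Variable P : probability T R.
Hypothesis exU : exists U : {RV P >-> R}, uniform01 U.
Implicit Types (f g : R -> R) (U : {RV P >-> R}).

Lemma integral_eq_off_point f g (u v : R) : increasing01 f -> increasing01 g ->
    (forall x, x != u -> g x = f x) -> 0 <= v <= 1 ->
  \int[lebesgue_measure]_(x in `[0, v]) g x =
  \int[lebesgue_measure]_(x in `[0, v]) f x.
Proof.
move=> incf incg gf /andP[v0 v1].
have sub : `[0, v]%classic `<=` (`[0, 1]%classic : set R).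
  by apply: subset_itvl; rewrite bnd_simp.
congr fine; apply: ae_eq_integral => //.
- by apply/measurable_EFinP; exact: increasing01_measurable.
- by apply/measurable_EFinP; exact: increasing01_measurable.
exists [set u]; split; [exact: measurable_set1|exact: lebesgue_measure_set1|].
move=> x /= nx; apply/eqP; apply: contrapT => /negP xu; apply: nx => _.
by rewrite gf.
Qed.

(** Changing one value alters no integral, so [g] is again a calibrator, and admissibility of [f]
    excludes a strict decrease at [u]. *)
Lemma admissible_off_point f g (u : R) : 0 <= u <= 1 ->
    admissible (p_to_pstar_calibrator P) f -> increasing01 g ->
    (forall x, x != u -> g x = f x) -> g u <= f u ->
  f u = g u.
Proof.
move=> u01 [calf nodom] incg gf gu; have [incf _] := calf.
apply: contrapT => fgu; apply: nodom; exists g; split.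
  apply: integral_p_to_pstar => // v v01.
  by rewrite (integral_eq_off_point incf incg gf v01);
    have [] := p_to_pstar_integral exU calf v01.
split=> [x _|gfE]; last by apply: fgu; rewrite gfE// in_itv.
by have [->//|/gf->] := eqVneq x u.
Qed.

Lemma admissible_at0 f : admissible (p_to_pstar_calibrator P) f -> f 0 = 0.
Proof.
move=> admf; have [[[f0 hf] _] _] := admf.
pose g x := if x == 0 then 0 else f x.
have g_off x : x != 0 -> g x = f x by rewrite /g => /negPf->.
have g_at : g 0 = 0 by rewrite /g eqxx.
rewrite -[RHS]g_at; apply: (admissible_off_point _ admf) => //.
- by rewrite lexx ler01.
- split=> [x x01|x y x01 y01 xy]; rewrite /g; case: ifP => // x0.
  + exact: f0.
  + by case: ifP => // _; exact: f0.
  + case: ifP => [/eqP y0|_]; last exact: hf.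
    move: x01; rewrite in_itv/= => /andP[x0' _].
    by move: x0; rewrite eq_le x0' andbT -y0 xy.
- by rewrite g_at f0// in_itv/= lexx ler01.
Qed.

(** If [f] jumps by at least [e] when reaching [u] from the left, lowering [f u] by [e] keeps it
    increasing. The new value is nonnegative because it still exceeds [f 0]. *)
Lemma admissible_left_continuous f : admissible (p_to_pstar_calibrator P) f ->
  left_continuous01 f.
Proof.
move=> admf; have [[[f0 hf] _] _] := admf.
move=> u /andP[u0 u1].
suff near_sup e : 0 < e -> exists x, [/\ 0 <= x, x < u & f u - e <= f x].
  apply/cvgrPdist_le => e e0; have [x [x0 xu fx]] := near_sup e e0.
  near=> y.
  have xy : x < y by near: y; exact: nbhs_left_gt.
  have yu : y < u by near: y; exact: nbhs_left_lt.
  have fxy : f x <= f y by apply: hf; rewrite ?in_itv/=; lra.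
  have fyu : f y <= f u by apply: hf; rewrite ?in_itv/=; lra.
  by rewrite ger0_norm; lra.
move=> e0; apply: contrapT => nx.
have gap x : 0 <= x -> x < u -> f x < f u - e.
  by move=> x0 xu; rewrite ltNge; apply/negP => fx; apply: nx; exists x.
pose g x := if x == u then f u - e else f x.
have g_at : g u = f u - e by rewrite /g eqxx.
suff : f u = g u by rewrite g_at; lra.
have f00 : 0 <= f 0 by rewrite f0// in_itv/= lexx ler01.
have f0u := gap _ (lexx 0) u0.
apply: (admissible_off_point _ admf).
- by rewrite u1 ltW.
- split=> [x x01|x y x01 y01 xy]; rewrite /g.
    by case: ifP => _; [lra|exact: f0].
  case: ifP => [/eqP xu|/eqP xu]; case: ifP => [/eqP yu|/eqP yu] //.
  + have := hf _ _ x01 y01 xy; rewrite xu; lra.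
  + have xltu : x < u by rewrite lt_neqAle -yu xy andbT yu; exact/eqP.
    by apply/ltW/gap => //; move: x01; rewrite in_itv/= => /andP[].
  + exact: hf.
- by move=> x; rewrite /g => /negPf->.
- by rewrite g_at; lra.
Unshelve. all: by end_near. Qed.

(* Otherwise truncating [f] at the level [c], chosen so that the total integral
   stays at least [1/2], gives a strictly better calibrator: for [v <= c] the
   variables [f(U)] and [min(f(U), c)] have the same expected shortfall below
   [v], and for [v > c] the bound follows from the one at [1]. *)
Lemma admissible_integral f : admissible (p_to_pstar_calibrator P) f ->
  \int[lebesgue_measure]_(u in `[0, 1]) f u = 1 / 2.
Proof.
move=> [calf nodom]; have [incf _] := calf; have [f0 hf] := incf.
have i11 : 0 <= (1 : R) <= 1 by rewrite ler01 lexx.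
have [U unifU] := exU.
have mU : measurable_fun setT U by exact: measurable_funPT.
have hid : {homo @id R : x y / x <= y} by [].
have bfU := @bounded_rv_increasing01 _ _ _ id f U hid incf mU.
have [F1 _] := p_to_pstar_integral exU calf i11.
apply/eqP; rewrite eq_le; apply/andP; split; last by move: F1; rewrite expr1n.
rewrite leNgt; apply/negP => F1gt; apply: nodom.
move: F1gt; rewrite -(Expect_uniform01T unifU incf).
set F := \int[P]_w _ => F1gt.
(* Since [f <= f 1], truncation at [c] lowers [f] by at most the excess [F - 1 / 2], so the mean
   stays at least [1 / 2]; at 1 the decrease is strict. *)
pose c := f 1 - (F - 1 / 2); pose g x := Num.min (f x) c.
have f_le1 w : f (clamp01 (U w)) <= f 1.
  by have /andP[] := increasing01_clamp_bounds (U w) incf.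
have Ff1 : F <= f 1.
  rewrite -[leRHS](Expect_cst P); apply: le_Expect => //.
  exact: bounded_rv_cst.
have c0 : 0 <= c by rewrite /c; lra.
have incg : increasing01 g.
  split=> [x x01|x y x01 y01 xy]; rewrite /g; first by rewrite le_min f0.
  by rewrite le_min !ge_min lexx orbT andbT hf.
have bgU := @bounded_rv_increasing01 _ _ _ id g U hid incg mU.
have G1 : 1 / 2 <= \int[P]_w g (clamp01 (U w)).
  have bcst := bounded_rv_cst T (F - 1 / 2).
  have := @le_Expect _ _ _ P _ _ (bounded_rvB bfU bcst) bgU.
  rewrite (@ExpectB _ _ _ P _ _ bfU bcst)/= Expect_cst -/F => /(_ _)/wrap[w|].
    by rewrite /g le_min /c; have := f_le1 w; lra.
  by apply: le_trans; lra.
exists g; split; last first.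
  split=> [x _|gf]; first by rewrite /g ge_min lexx.
  have := gf 1; rewrite in_itv/= lexx ler01 => /(_ isT).
  have : g 1 <= c by rewrite /g ge_min lexx orbT.
  by rewrite /c; lra.
apply: integral_p_to_pstar => // v v01; have /andP[v0 v1] := v01.
have [vc|cv] := leP v c.
  apply: (Expect_min_integral unifU incg v01).
  have [_ /(_ _ unifU)] := p_to_pstar_integral exU calf v01.
  congr (_ <= _); apply: eq_Rintegral => w _; rewrite /g.
  have [fc|cf] := leP (f (clamp01 (U w))) c; first by [].
  by rewrite !min_r; lra.
(* As [g <= c < v], the part of the integral beyond [v] is at most [c * (1 - v)], and
   [1 / 2 - v * (1 - v)] equals [v ^+ 2 / 2 + (1 - v) ^+ 2 / 2]. *)
rewrite -(Expect_uniform01_le unifU incg v01).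
have bray := bounded_rv_ray U v.
have bcray := bounded_rvM (bounded_rv_cst T c) bray.
have bcst := bounded_rv_cst T c.
have := @le_Expect _ _ _ P _ _ (bounded_rvD (bounded_rvB bgU bcst) bcray)
  (bounded_rvM bgU bray).
rewrite (@ExpectD _ _ _ P _ _ (bounded_rvB bgU bcst) bcray).
rewrite (@ExpectB _ _ _ P _ _ bgU bcst) (@ExpectZ _ _ _ P c _ bray)/=.
rewrite Expect_cst Expect_ray// => /(_ _)/wrap[w|].
  rewrite indic_ray; have : g (clamp01 (U w)) <= c by rewrite /g ge_min lexx orbT.
  by case: (leP _ v) => Uv /=; lra.
apply: le_trans.
have : c * (1 - v) <= v * (1 - v) by rewrite ler_wpM2r ?subr_ge0// ltW.
have : 0 <= (1 - v) ^+ 2 by exact: sqr_ge0.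
by rewrite sqrrB expr1n; lra.
Qed.

(** If [g x < f x] with [x > 0], left-continuity keeps [f] above the midpoint [m] on an interval
    from [y] to [x], where [g <= g x]. The mean of [g] then falls below [1 / 2] by at least
    [(m - g x) * (x - y)], which no calibrator allows. *)
Lemma undominated_of_integral f g : increasing01 f -> left_continuous01 f ->
    f 0 = 0 -> \int[lebesgue_measure]_(u in `[0, 1]) f u = 1 / 2 ->
    p_to_pstar_calibrator P g -> dominates_cal g f ->
  {in `[0, 1], g =1 f}.
Proof.
move=> incf lcf f00 intf calg gf x x01.
have [incg _] := calg; have [g0 hg] := incg; have [_ hf] := incf.
move: (x01); rewrite in_itv/= => /andP[x0 x1].
apply/eqP; rewrite eq_le gf//= leNgt; apply/negP => gfx.
move: x0; rewrite le_eqVlt => /predU1P[x0|x0].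
  by move: gfx; rewrite -x0 f00 ltNge g0// in_itv/= lexx ler01.
pose m := (g x + f x) / 2.
have [y [y0 yx fy]] : exists y, [/\ 0 <= y, y < x & m < f y].
  have := lcf x; rewrite x0 x1 => /(_ isT) fx.
  near (x^'-) => y; exists y; split.
  - by near: y; exact: nbhs_left_ge.
  - by near: y; exact: nbhs_left_lt.
  - by near: y; apply: cvgr_gt fx _ _; rewrite /m; lra.
have [U unifU] := exU.
have mU : measurable_fun setT U by exact: measurable_funPT.
have hid : {homo @id R : x y / x <= y} by [].
have bfU := @bounded_rv_increasing01 _ _ _ id f U hid incf mU.
have bgU := @bounded_rv_increasing01 _ _ _ id g U hid incg mU.
have i11 : 0 <= (1 : R) <= 1 by rewrite ler01 lexx.
have [] := p_to_pstar_integral exU calg i11.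
rewrite expr1n -(Expect_uniform01T unifU incg) => G1 _.
move: intf; rewrite -(Expect_uniform01T unifU incf) => F1.
have bx := bounded_rv_ray U x; have by_ := bounded_rv_ray U y.
have bm := bounded_rv_cst T (m - g x).
have bD := bounded_rvM bm (bounded_rvB bx by_).
have := @le_Expect _ _ _ P _ _ (bounded_rvD bgU bD) bfU.
rewrite (@ExpectD _ _ _ P _ _ bgU bD).
rewrite (@ExpectZ _ _ _ P (m - g x) _ (bounded_rvB bx by_)).
rewrite (@ExpectB _ _ _ P _ _ bx by_)/= F1.
rewrite !Expect_ray//; try lra.
move=> /(_ _)/wrap[w|].
  rewrite !indic_ray; have gfw := gf _ (clamp01_in (U w)).
  case: (leP _ x) => Ux; case: (leP _ y) => Uy; rewrite /= ?subrr ?mulr0 ?addr0//.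
  - rewrite subr0 mulr1.
    have gw : g (clamp01 (U w)) <= g x by apply: hg; rewrite ?clamp01_in// clamp01_le// ltW.
    have fw : f y <= f (clamp01 (U w)).
      by apply: hf; rewrite ?clamp01_in ?in_itv/= ?clamp01_ge//; lra.
    by move: fy; rewrite /m; lra.
  - by lra.
have : 0 < (m - g x) * (x - y) by rewrite mulr_gt0 ?subr_gt0// /m; lra.
lra.
Unshelve. all: by end_near. Qed.

End Admissibility.

Theorem theorem6p1 (R : realType) (d : measure_display) (T : measurableType d)
    (P : probability T R) (P_atomless : atomless P) :
  (pstar_to_p_calibrator P (fun u : R => Num.min (2 * u) 1) /\
   forall g : R -> R, pstar_to_p_calibrator P g ->
     dominates_cal (fun u : R => Num.min (2 * u) 1) g) /\
  (forall f : R -> R, increasing01 f ->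
     (admissible (p_to_pstar_calibrator P) f <->
      [/\ left_continuous01 f,
          f 0 = 0,
          (forall v : R, 0 < v < 1 ->
             v ^+ 2 / 2 <= \int[lebesgue_measure]_(u in `[0, v]) f u) &
          \int[lebesgue_measure]_(u in `[0, 1]) f u = 1 / 2])).
Proof.
have exU := atomless_uniform P_atomless.
split; first by split=> [|g]; [exact: double_pstar_to_p|exact: pstar_to_p_ge].
move=> f incf; split=> [admf|[lcf f0 intf int1]].
  split.
  - exact: admissible_left_continuous admf.
  - exact: admissible_at0 admf.
  - move=> v /andP[v0 v1]; have [calf _] := admf.
    have v01 : 0 <= v <= 1 by rewrite !ltW.
    by have [] := p_to_pstar_integral exU calf v01.
  - exact: admissible_integral admf.
split; last first.
  by move=> [g [calg [gf]]]; apply; exact: undominated_of_integral calg gf.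
(* The assumed bound covers the open interval only: at 0 both sides vanish, and at 1 it is the
   condition on the total integral. *)
apply: integral_p_to_pstar => // v /andP[].
rewrite le_eqVlt => /predU1P[<- _|v0].
  by rewrite set_itv1 Rintegral_set1 expr0n/= mul0r.
rewrite le_eqVlt => /predU1P[->|v1]; last by rewrite intf ?v0.
by rewrite int1 expr1n.
Qed.
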